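(* $f(7)=17$. In particular, there exists an intersecting $7$-partite hypergraph with covering number $6$.
   Context: A hypergraph is $r$-partite if its vertex set can be partitioned into $r$ sets (the sides) so that every edge contains exactly one vertex from each side; it is intersecting if every two edges share a vertex. The covering number $\tau(H)$ is the minimum size of a set of vertices meeting every edge. $f(r)$ is the smallest integer $k$ for which there exists an intersecting $r$-partite hypergraph $H$ with $k$ edges and $\tau(H)\ge r-1$. *)

(* Defs.v *)
From mathcomp Require Import all_boot.
Set Implicit Arguments.
Unset Strict Implicit.
Unset Printing Implicit Defensive.

(* A finite hypergraph with vertex set T is given by its set of edges
   H : {set {set T}}; in particular its edges are pairwise distinct. *)

(* The function side encodes the partition of the vertex set into r sides,
   namely its r fibres. *)
Definition partite (r : nat) (T : finType) (H : {set {set T}}) : Prop :=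
  exists side : T -> 'I_r,
    forall (e : {set T}) (i : 'I_r),
      e \in H -> #|e :&: [set x | side x == i]| = 1.

Definition intersecting (T : finType) (H : {set {set T}}) : Prop :=
  forall e1 e2 : {set T}, e1 \in H -> e2 \in H -> e1 :&: e2 != set0.

Definition vertex_cover (T : finType) (H : {set {set T}}) (C : {set T}) : bool :=
  [forall e in H, e :&: C != set0].

(* When no edge is empty (e.g. for an r-partite hypergraph with 0 < r) the set
   of all vertices is a cover, so the minimum is attained. *)
Definition tau (T : finType) (H : {set {set T}}) : nat :=
  #|[arg min_(C < [set: T] | vertex_cover H C) #|C|]|.

Definition f_witness (r k : nat) : Prop :=
  exists (T : finType) (H : {set {set T}}),
    [/\ partite r H, intersecting H, #|H| = k & r - 1 <= tau H].

(* "f(r) = k". The function f is represented by its graph, since a witness need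
   not exist for every r. *)
Definition f_is (r k : nat) : Prop :=
  f_witness r k /\ forall k' : nat, f_witness r k' -> k <= k'.

(* Main.v *)
Require Import Defs.
From mathcomp Require Import all_boot zify.

(** Lower bound.  Pad a family of at most 16 edges to 16 rows, seen as seven equivalence
    relations ("sides") on the rows.  Two rows always share a class, so if no five
    vertices cover everything, then [j] vertices cover at most [5 + 2j] rows: the rest
    could be covered in pairs.  Counting pairs of rows on each side, this gives maximum
    degree 5, attained.  A vertex [v] of degree 5 and a vertex covering four further rows
    are impossible: the other seven rows would form a near-one-factorization of [K_7] on
    which the four rows of the second vertex induce matchings of sizes 3, 3, 3 and at
    least 2, and three disjoint pairs from different matchings give a small cover.
    Hence every class has at most three rows outside the star [A] of [v].  The number of
    pairs of rows not both in [A] is 110; at most 8 of them meet on the side of [v] and at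
    most 17 on every other side, so equality holds everywhere and all class sizes are known.
    Either the eleven rows outside [A] carry a linear system of 14 triples without three
    disjoint ones, which does not exist, or there is a second vertex of degree 5 sharing
    two rows with [v], and the degrees of these two rows are contradictory.

    Upper bound.  An explicit family of 17 edges, found by computer search. *)

Set Implicit Arguments.
Unset Strict Implicit.
Unset Printing Implicit Defensive.

(** * Rows and covers *)

Section Rows.

Variables (I : finType) (V : eqType) (M : I -> 'I_7 -> V).

(** The edges through the vertex [M x t]. Vertices are represented throughout by a side together
    with a row through the vertex; several rows may name the same vertex. *)
Definition star (t : 'I_7) (x : I) : {set I} := [set y | M y t == M x t].

Definition covered (vs : seq ('I_7 * I)) : {set I} :=
  \bigcup_(v <- vs) star v.1 v.2.

Definition meet (x y : I) : nat := #|[set t | M x t == M y t]|.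

Lemma star_refl t x : x \in star t x.
Proof. by rewrite inE. Qed.

Lemma mem_star t x y : (y \in star t x) = (M y t == M x t).
Proof. by rewrite inE. Qed.

Lemma eq_star t x y : (star t y == star t x) = (M y t == M x t).
Proof.
apply/eqP/eqP => [e|e]; last by apply/setP=> z; rewrite !inE e.
by have := star_refl t y; rewrite e inE => /eqP.
Qed.

Lemma covered_cons v vs : covered (v :: vs) = star v.1 v.2 :|: covered vs.
Proof. exact: big_cons. Qed.

Lemma meetxx x : meet x x = 7.
Proof.
rewrite /meet (_ : [set t | _] = setT) ?cardsT ?card_ord //.
by apply/setP=> t; rewrite !inE eqxx.
Qed.

(** Double counting of triples of a side and two rows in the same class on it. *)
Lemma sum_star (X Y : {set I}) :
  \sum_(t < 7) \sum_(x in X) #|star t x :&: Y| = \sum_(x in X) \sum_(y in Y) meet x y.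
Proof.
rewrite exchange_big; apply: eq_bigr => x _ /=.
transitivity (\sum_(t < 7) \sum_(y in Y) (M y t == M x t)).
  apply: eq_bigr => t _; rewrite -sum1_card big_mkcond [RHS]big_mkcond /=.
  by apply: eq_bigr => y _; rewrite !inE andbC; case: (y \in Y); case: eqP.
rewrite exchange_big; apply: eq_bigr => y _ /=.
rewrite /meet -sum1_card [RHS]big_mkcond /=; apply: eq_bigr => t _.
by rewrite inE eq_sym; case: eqP.
Qed.

Definition classes t : seq {set I} := enum [set star t x | x : I].

Lemma classes_uniq t : uniq (classes t).
Proof. exact: enum_uniq. Qed.

Lemma mem_classes t c : reflect (exists x, c = star t x) (c \in classes t).
Proof.
rewrite mem_enum; apply: (iffP imsetP) => [[x _ ->]|[x ->]]; first by exists x.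
by exists x.
Qed.

Lemma star_classes t x : star t x \in classes t.
Proof. by apply/mem_classes; exists x. Qed.

Lemma classes_star t c x : c \in classes t -> x \in c -> c = star t x.
Proof.
by case/mem_classes=> y ->; rewrite inE => /eqP e; apply/setP=> z; rewrite !inE e.
Qed.

Lemma sum_classes t (X : {set I}) (F : {set I} -> nat) :
  \sum_(x in X) F (star t x) = \sum_(c <- classes t) #|c :&: X| * F c.
Proof.
rewrite big_enum /= (partition_big (star t) (mem [set star t x | x : I])) /=; last first.
  by move=> x _; apply: imset_f.
apply: eq_bigr => c /imsetP[y _ ->].
rewrite -sum1_card big_distrl /=.
rewrite [LHS](eq_bigr (fun=> 1 * F (star t y))); last first.
  by move=> x /andP[_ /eqP->]; rewrite mul1n.
by apply: eq_bigl => x; rewrite !inE eq_star andbC.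
Qed.

Lemma card_classes t (X : {set I}) : #|X| = \sum_(c <- classes t) #|c :&: X|.
Proof.
rewrite -sum1_card (sum_classes t X (fun=> 1)).
by apply: eq_bigr => c _; rewrite muln1.
Qed.

Lemma sum_star_sq t (X : {set I}) :
  \sum_(x in X) #|star t x :&: X| = \sum_(c <- classes t) #|c :&: X| ^ 2.
Proof. by rewrite (sum_classes t X (fun c => #|c :&: X|)). Qed.

(** The sum is one of squares of part sizes, and a square has the parity of its root. Two bounds
    below gain one from this. *)
Lemma odd_sum_star t (X : {set I}) : odd (\sum_(x in X) #|star t x :&: X|) = odd #|X|.
Proof.
rewrite sum_star_sq (card_classes t X).
elim: (classes t) => [|c cs IH]; first by rewrite !big_nil.
by rewrite !big_cons !oddD IH oddX.
Qed.

Lemma covered_classes t (cs : seq {set I}) :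
  {subset cs <= classes t} ->
  exists2 vs, size vs = size cs & covered vs = \bigcup_(c <- cs) c.
Proof.
elim: cs => [|c cs IH] h; first by exists [::]; rewrite // /covered !big_nil.
have [|vs sz e] := IH; first by move=> d hd; apply: h; rewrite inE hd orbT.
have [x ex] := mem_classes t c (h c (mem_head _ _)).
by exists ((t, x) :: vs); rewrite /= ?sz // covered_cons big_cons e ex.
Qed.

Lemma card_bigcup_classes t (cs : seq {set I}) (X : {set I}) :
  uniq cs -> {subset cs <= classes t} ->
  #|(\bigcup_(c <- cs) c) :&: X| = \sum_(c <- cs) #|c :&: X|.
Proof.
elim: cs => [|c cs IH] /=; first by rewrite !big_nil set0I cards0.
case/andP=> nc us h; rewrite !big_cons setIUl cardsU -IH //; last first.
  by move=> d hd; apply: h; rewrite inE hd orbT.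
rewrite [X in _ - X](_ : _ = 0) ?subn0 //; apply/eqP; rewrite cards_eq0.
apply/eqP/setP=> x; rewrite !inE; apply/negP=> /andP[/andP[xc _] /andP[xcs _]].
have: x \in \bigcup_(d <- cs) d := xcs.
rewrite bigcup_seq => /bigcupP[d hd xd].
have hd' : d \in classes t by apply: h; rewrite inE hd orbT.
move: nc; rewrite (classes_star (h c (mem_head _ _)) xc).
by rewrite -(classes_star hd' xd) hd.
Qed.

Hypothesis inter : forall x y, exists t, M x t == M y t.

Lemma meet_gt0 x y : 0 < meet x y.
Proof. by have [t h] := inter x y; apply/card_gt0P; exists t; rewrite inE. Qed.

(** Two rows always share a class, so each vertex can dispose of two rows. *)
Lemma cover_pairs n (X : {set I}) :
  #|X| <= n.*2 -> exists2 vs, size vs <= n & X \subset covered vs.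
Proof.
elim: n X => [|n IH] X hX.
  move: hX; rewrite leqn0 cards_eq0 => /eqP->.
  by exists [::]; rewrite ?sub0set.
have [->|[x hx]] := set_0Vmem X; first by exists [::]; rewrite ?sub0set.
(* If [x] is the only row left, it is paired with itself. *)
have [y hy] : exists y, #|X :\ x :\ y| <= n.*2 /\ (y \in X).
  have [e|[y hy]] := set_0Vmem (X :\ x).
    by exists x; split=> //; rewrite e set0D cards0.
  exists y; split; last by move: hy; rewrite inE => /andP[].
  by have := cardsD1 x X; have := cardsD1 y (X :\ x); rewrite hx hy; lia.
have [t ht] := inter x y; case: hy => hc hy.
have [vs sz sub] := IH _ hc.
exists ((t, x) :: vs); rewrite //= covered_cons; apply/subsetP=> z hz.
rewrite inE /= mem_star; case: (eqVneq z x) => [->|zx]; first by rewrite eqxx.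
case: (eqVneq z y) => [->|zy]; first by rewrite eq_sym ht.
by rewrite (subsetP sub) ?orbT // !inE zy zx hz.
Qed.

Hypothesis card_I : #|I| = 16.
Hypothesis nocov : forall vs, size vs <= 5 -> exists x, x \notin covered vs.

(* Otherwise the uncovered rows could be covered in pairs. *)
Lemma cov_bound vs : size vs <= 5 -> #|covered vs| <= 5 + (size vs).*2.
Proof.
move=> sz; rewrite leqNgt; apply/negP => h.
have [|us su sub] := @cover_pairs (5 - size vs) (~: covered vs).
  by have := cardsC (covered vs); rewrite card_I -mul2n; lia.
have [|x] := @nocov (vs ++ us); first by rewrite size_cat; lia.
rewrite /covered big_cat inE /= -/(covered vs) -/(covered us).
case: (boolP (x \in covered vs)) => //= hx.
by rewrite (subsetP sub) // inE.
Qed.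

Lemma cov_seq vs (l : seq I) :
  size vs <= 5 -> uniq l -> {subset l <= covered vs} -> size l <= 5 + (size vs).*2.
Proof.
move=> sz ul sub; apply: leq_trans (cov_bound sz).
by rewrite -(card_uniqP ul); apply/subset_leq_card/subsetP.
Qed.

(** Classes on one side are disjoint, so their parts in [X] add up, and [cov_bound] applies to [vs]
    with one further vertex per class. *)
Lemma cov_classes vs t cs (X : {set I}) :
  size vs + size cs <= 5 -> uniq cs -> {subset cs <= classes t} ->
  [disjoint X & covered vs] ->
  #|covered vs| + \sum_(c <- cs) #|c :&: X| <= 5 + (size vs + size cs).*2.
Proof.
move=> sz us sub dX; have [ws sv e] := covered_classes sub.
have := @cov_bound (vs ++ ws); rewrite size_cat sv => /(_ sz); apply: leq_trans.
rewrite /covered big_cat /= -/(covered vs) -/(covered ws) e.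
rewrite -(card_bigcup_classes _ us sub).
rewrite -[leqLHS](_ : #|covered vs :|: \bigcup_(c <- cs) c :&: X| = _).
  by apply/subset_leq_card/setUS/subsetIl.
rewrite cardsU [X in _ - X](_ : _ = 0) ?subn0 //; apply/eqP.
rewrite cards_eq0 setI_eq0 disjoint_sym.
by apply: disjointWl dX; apply: subsetIr.
Qed.

Lemma cov_star vs t x (X : {set I}) : size vs <= 4 -> [disjoint X & covered vs] ->
  #|covered vs| + #|star t x :&: X| <= 7 + (size vs).*2.
Proof.
move=> sz dX; have := @cov_classes vs t [:: star t x] X.
rewrite big_seq1 /= addn1 doubleS !addnS; apply=> //.
by move=> c; rewrite inE => /eqP->; apply: star_classes.
Qed.

(** Otherwise [n.+1] such classes together with [vs] would cover more rows than [cov_bound]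
    allows. *)
Lemma count_classes vs t (X : {set I}) k (p : pred {set I}) :
  size vs <= 4 -> [disjoint X & covered vs] ->
  (forall c, c \in classes t -> p c -> k <= #|c :&: X|) ->
  forall n, size vs + n.+1 <= 5 ->
  5 + (size vs + n.+1).*2 < #|covered vs| + n.+1 * k -> count p (classes t) <= n.
Proof.
move=> sz dX hk n hn hlt; rewrite leqNgt; apply/negP => hc.
have hs : size (take n.+1 [seq c <- classes t | p c]) = n.+1.
  by rewrite size_takel // size_filter.
have sub : {subset take n.+1 [seq c <- classes t | p c] <= [seq c <- classes t | p c]}.
  by move=> c /mem_take.
have := @cov_classes vs t (take n.+1 [seq c <- classes t | p c]) X.
rewrite hs => /(_ hn) h; have {}h := h _ _ dX.
suff : n.+1 * k <= \sum_(c <- take n.+1 [seq c <- classes t | p c]) #|c :&: X|.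
  have := h (take_uniq _ (filter_uniq _ (classes_uniq t))).
  have s2 : {subset take n.+1 [seq c <- classes t | p c] <= classes t}.
    by move=> c /sub; rewrite mem_filter => /andP[].
  move=> /(_ s2) h1 h2; move: hlt; rewrite ltnNge => /negP; apply.
  by apply: leq_trans h1; rewrite leq_add2l.
rewrite -{1}hs -sum1_size big_distrl /= big_seq [leqRHS]big_seq; apply: leq_sum => c.
by move=> /sub; rewrite mem_filter mul1n => /andP[pc hc']; apply: hk.
Qed.

Lemma covered1 v : covered [:: v] = star v.1 v.2.
Proof. by rewrite /covered big_seq1. Qed.

Lemma sum_meet_ge (X Y : {set I}) :
  #|X| * #|Y| <= \sum_(x in X) \sum_(y in Y) meet x y.
Proof.
rewrite -sum1_card big_distrl; apply: leq_sum => x _ /=; rewrite mul1n.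
by rewrite -sum1_card; apply: leq_sum => y _; apply: meet_gt0.
Qed.

Lemma sum_meet_self (x : I) (X : {set I}) : x \in X ->
  6 + #|X| <= \sum_(y in X) meet x y.
Proof.
move=> hx; rewrite (cardsD1 x) hx (big_setD1 x) //= meetxx -sum1_card.
rewrite addnA leq_add2l; apply: leq_sum => y _; exact: meet_gt0.
Qed.

Lemma sum_meet_sq (X : {set I}) :
  #|X| * (6 + #|X|) <= \sum_(x in X) \sum_(y in X) meet x y.
Proof.
rewrite -{1}sum1_card big_distrl; apply: leq_sum => x hx /=; rewrite mul1n.
exact: sum_meet_self.
Qed.

Lemma sum_star1 x (Y : {set I}) :
  \sum_(t < 7) #|star t x :&: Y| = \sum_(y in Y) meet x y.
Proof.
have := sum_star [set x] Y; rewrite big_set1 => <-.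
by apply: eq_bigr => t _; rewrite big_set1.
Qed.

Lemma disjointC_covered vs : [disjoint ~: covered vs & covered vs].
Proof. by rewrite disjoint_sym disjoints_subset setCK. Qed.

(** [cov_bound] gives 7. In case of equality a further vertex covers at most two of the nine
    remaining rows, so such a row has at most 14 meetings with these nine over the seven sides. But
    it meets itself seven times and each of the other eight at least once, which makes 15. *)
Lemma star_le6 t x : #|star t x| <= 6.
Proof.
have h7 : #|star t x| <= 7 by have := @cov_bound [:: (t, x)]; rewrite covered1 /=; apply.
rewrite leqNgt; apply/negP => h; have {h7}h : #|star t x| = 7 by lia.
pose X := ~: covered [:: (t, x)].
have cX : #|X| = 9 by have := cardsC (covered [:: (t, x)]); rewrite card_I /X covered1 /=; lia.
have /set0Pn[z hz] : X != set0 by rewrite -card_gt0 cX.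
have := sum_meet_self hz; rewrite -sum_star1 cX.
suff : \sum_(s < 7) #|star s z :&: X| <= \sum_(s < 7) 2 by rewrite sum_nat_const card_ord; lia.
apply: leq_sum => s _.
by have := @cov_star [:: (t, x)] s z X isT (disjointC_covered _); rewrite covered1 /= h; lia.
Qed.

(** Outside a star of six rows, each side splits the other ten rows into parts of size at most 3, at
    most one of them of size 3. The sum of squares is at most 23, hence at most 22 by parity, but
    the seven sides must total at least [10 * 16]. *)
Lemma star_le5 t x : #|star t x| <= 5.
Proof.
rewrite leqNgt; apply/negP => h; have {}h : #|star t x| = 6 by have := star_le6 t x; lia.
pose X := ~: covered [:: (t, x)].
have cX : #|X| = 10 by have := cardsC (covered [:: (t, x)]); rewrite card_I /X covered1 /=; lia.
have := sum_meet_sq X; rewrite -sum_star cX.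
suff : \sum_(s < 7) \sum_(z in X) #|star s z :&: X| <= \sum_(s < 7) 22.
  by rewrite sum_nat_const card_ord; lia.
apply: leq_sum => s _.
have le3 c : c \in classes s -> #|c :&: X| <= 3.
  case/mem_classes=> z ->.
  by have := @cov_star [:: (t, x)] s z X isT (disjointC_covered _); rewrite covered1 /= h; lia.
have c3 : count (fun c => #|c :&: X| == 3) (classes s) <= 1.
  apply: (@count_classes [:: (t, x)] s X 3) => //; first exact: disjointC_covered.
    by move=> c _ /eqP->.
  by rewrite covered1 /= h.
have := odd_sum_star s X; rewrite cX.
suff : \sum_(z in X) #|star s z :&: X| <= 23 by rewrite leq_eqVlt => /orP[/eqP->|].
rewrite sum_star_sq.
(* Termwise [n ^ 2 <= 2 * n + 3 * (n == 3)] for [n <= 3]. *)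
apply: (@leq_trans (\sum_(c <- classes s) (2 * #|c :&: X| + 3 * (#|c :&: X| == 3)))).
  rewrite big_seq [leqRHS]big_seq; apply: leq_sum => c /le3.
  by case: #|_| => [|[|[|[|]]]].
rewrite big_split /= -!big_distrr /= -card_classes cX.
move: c3; rewrite -sum1_count big_mkcond /=.
by case: (\sum_(i <- _) _) => [|[|n]] // _.
Qed.

End Rows.

(** * Matchings of seven points *)

(* Unlike [has], this stops at the first hit under call-by-value evaluation. *)
Fixpoint exists_in (T : Type) (p : T -> bool) (s : seq T) : bool :=
  if s is x :: s' then if p x then true else exists_in p s' else false.

Lemma exists_inE (T : Type) (p : T -> bool) s : exists_in p s = has p s.
Proof. by elim: s => //= x s ->; case: (p x). Qed.

(** Written with conditionals so that call-by-value evaluation stops at the first common point. *)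
Definition disj2 (p q : nat * nat) : bool :=
  if p.1 == q.1 then false else if p.1 == q.2 then false else
  if p.2 == q.1 then false else p.2 != q.2.

Lemma disj2E p q :
  disj2 p q = [&& p.1 != q.1, p.1 != q.2, p.2 != q.1 & p.2 != q.2].
Proof. by rewrite /disj2; do 3 case: eqP. Qed.

Lemma disj2_sym p q : disj2 p q = disj2 q p.
Proof.
rewrite !disj2E (eq_sym p.1 q.1) (eq_sym p.1 q.2) (eq_sym p.2 q.1) (eq_sym p.2 q.2).
by case: (q.1 == p.1) => //=; case: (q.1 == p.2); rewrite ?andbF.
Qed.

Definition rainbow (a b c : seq (nat * nat)) : bool :=
  exists_in (fun p => exists_in (fun q => if disj2 p q then
    exists_in (fun r => if disj2 p r then disj2 q r else false) c else false) b) a.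

Definition repeated (a b c : seq (nat * nat)) : bool :=
  exists_in (fun p => if exists_in (pred1 p) b then exists_in (disj2 p) c else false) a.

(** The two configurations excluded by [no_rainbow] and [no_repeat] below: three disjoint pairs, one
    from each matching, or a pair common to two matchings and disjoint from a pair of the third. *)
Definition obstructed (a b c : seq (nat * nat)) : bool :=
  if rainbow a b c then true else if repeated a b c then true else
  if repeated a c b then true else repeated b c a.

(** Pairs are chosen by increasing first point, with [lo] the least one still allowed, so each
    matching occurs once. [P] receives the pairs in reverse order. *)
Fixpoint all_matchings (k lo : nat) (acc : seq (nat * nat))
    (P : seq (nat * nat) -> bool) : bool :=
  if k is k'.+1 then
    all (fun x => all (fun y =>
      if [&& lo <= x, x < y & all (disj2 (x, y)) acc]
      then all_matchings k' x.+1 ((x, y) :: acc) P else true) (iota 0 7)) (iota 0 7)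
  else P acc.

Definition matching (f : nat -> nat -> bool) (L : seq (nat * nat)) : bool :=
  [&& all (fun p => [&& p.1 < p.2, p.2 < 7 & f p.1 p.2]) L, pairwise disj2 L
    & sorted ltn (map fst L)].

Lemma all_matchingsP P k L f :
  all_matchings k 0 [::] P -> matching f L -> size L = k -> P (rev L).
Proof.
move=> h /and3P[h1 h2 h3] sL; rewrite -[rev L]/(catrev L [::]).
suff gen K l acc lo : all_matchings K lo acc P -> size l = K ->
    all (fun p => [&& p.1 < p.2, p.2 < 7 & f p.1 p.2]) l -> pairwise disj2 l ->
    sorted ltn (map fst l) -> allrel disj2 l acc -> all (fun p => lo <= p.1) l ->
    P (catrev l acc).
  by apply: (gen k L [::] 0) => //; [apply/allrelP | apply/allP].
elim: l K acc lo {L h h1 h2 h3 sL} => [|[x y] l IH] [|K] acc lo // h [sl].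
have {}h x0 y0 : x0 < 7 -> y0 < 7 -> [&& lo <= x0, x0 < y0 & all (disj2 (x0, y0)) acc] ->
    all_matchings K x0.+1 ((x0, y0) :: acc) P.
  move=> hx hy hg; have /allP/(_ y0) := allP h x0 ltac:(by rewrite mem_iota).
  by rewrite mem_iota hg; apply.
rewrite /=; move=> /andP[/and3P[xy y7 _] h1] /andP[h2 h2'] h3.
rewrite allrel_consl => /andP[h4 h4'] /andP[h5 _].
apply: (IH K _ x.+1) => //.
- apply: h; [exact: ltn_trans xy y7 | exact: y7 | by rewrite h5 xy].
- exact: path_sorted h3.
- rewrite allrel_consr h4' andbT; apply/allP=> p hp; rewrite disj2_sym.
  exact: allP h2 p hp.
- move: h3; rewrite path_sortedE; last exact: ltn_trans.
  by rewrite all_map => /andP[].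
Qed.

(* Up to relabelling, the first of the three matchings. *)
Definition matching1 : seq (nat * nat) := [:: (0, 1); (2, 3); (4, 5)].

Definition check_edge m2 m3 m4 : bool :=
  [|| obstructed matching1 m2 m4, obstructed matching1 m3 m4 | obstructed m2 m3 m4].

Definition check_matching3 m2 m3 : bool :=
  if obstructed matching1 m2 m3 then true
  else all_matchings 1 0 [::] (check_edge m2 m3).

Definition check_matching2 m2 : bool :=
  all_matchings 3 0 [::] (check_matching3 m2).

(** Exhaustive computation over the second and third matching. When these two are not obstructed
    with [matching1], any single pair of the fourth matching forces an obstruction. *)
Lemma check_matching2_true : all_matchings 3 0 [::] check_matching2.
Proof. by vm_compute. Qed.

Lemma matchings_obstructed f2 f3 f4 m2 m3 m4 :
  matching f2 m2 -> size m2 = 3 -> matching f3 m3 -> size m3 = 3 ->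
  matching f4 m4 -> size m4 = 1 ->
  obstructed matching1 (rev m2) (rev m3) \/ check_edge (rev m2) (rev m3) (rev m4).
Proof.
move=> h2 s2 h3 s3 h4 s4.
have c2 : check_matching2 (rev m2) := all_matchingsP check_matching2_true h2 s2.
have c3 : check_matching3 (rev m2) (rev m3) := all_matchingsP c2 h3 s3.
move: c3; rewrite /check_matching3; case: ifP => [|_ c4]; first by left.
by right; apply: all_matchingsP c4 h4 s4.
Qed.

(** Points of equal label are paired. No label occurs three times, so the pairs make up for the
    difference between points and labels; pairs with different labels are disjoint. *)
Lemma matching_of_labels (D : eqType) (f : nat -> D) n lo :
  (forall d, count (fun y => f y == d) (iota lo n) <= 2) ->
  exists L : seq (nat * nat),
    [/\ n <= size L + size (undup (map f (iota lo n))),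
        all (fun p => [&& lo <= p.1, p.1 < p.2, p.2 < lo + n & f p.1 == f p.2]) L,
        uniq [seq f p.1 | p <- L] & sorted ltn (map fst L)].
Proof.
elim: n lo => [|n IH] lo hc; first by exists [::].
have [|L [h1 h2 h3 h4]] := IH lo.+1.
  by move=> d; have := hc d; rewrite /=; lia.
have h2' : all (fun p => [&& lo <= p.1, p.1 < p.2, p.2 < lo + n.+1 & f p.1 == f p.2]) L.
  by apply/allP=> p /(allP h2) /and4P[*]; apply/and4P; split=> //; lia.
case: (boolP (f lo \in map f (iota lo.+1 n))) => hlo; last first.
  by exists L; split=> //=; rewrite (negPf hlo) /=; lia.
have [y hy ey] := mapP hlo; exists ((lo, y) :: L); split => /=.
- by rewrite hlo; lia.
- by move: hy; rewrite mem_iota h2' ey eqxx leqnn => /andP[-> h]; rewrite !andbT; lia.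
(* A pair of [L] with the label of [lo] would give this label a third occurrence. *)
- rewrite h3 andbT; apply/negP=> /mapP[p hp ep].
  have /and4P[a1 a2 a3 /eqP a4] := allP h2 p hp.
  have := hc (f lo); rewrite /= eqxx.
  have : 2 <= count (fun z => f z == f lo) (iota lo.+1 n).
    rewrite -size_filter -[2]/(size [:: p.1; p.2]); apply: uniq_leq_size.
      by rewrite /= inE andbT; lia.
    have pI : (p.1 \in iota lo.+1 n) && (p.2 \in iota lo.+1 n).
      by rewrite !mem_iota a1 a3 (ltn_trans a2 a3) (ltn_trans a1 a2).
    case/andP: pI => p1I p2I.
    move=> z; rewrite !inE mem_filter => /orP[]/eqP->; first by rewrite -ep eqxx.
    by rewrite -a4 -ep eqxx.
  by case: count => [|[|k]].
- rewrite path_sortedE; last exact: ltn_trans.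
  by rewrite h4 andbT all_map; apply/allP=> p /(allP h2) /and4P[].
Qed.

(** * A vertex of degree five and a disjoint vertex of degree four *)

(** This turns tight global counts into exact values on every side and for every pair of rows. *)
Lemma leq_sum_eq (T : finType) (P : pred T) (F G : T -> nat) :
  (forall i, P i -> G i <= F i) ->
  \sum_(i | P i) F i <= \sum_(i | P i) G i -> forall i, P i -> F i = G i.
Proof.
move=> h hs i Pi; apply/eqP; rewrite eqn_leq h // andbT.
move: hs; rewrite (bigD1 i) //= [X in _ <= X](bigD1 i) //= => hs.
have : \sum_(j | P j && (j != i)) G j <= \sum_(j | P j && (j != i)) F j.
  by apply: leq_sum => j /andP[Pj _]; apply: h.
by move: hs; move: (F i) (G i) (\sum_(j | _) F j) (\sum_(j | _) G j); lia.
Qed.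

Lemma sum7_le (F : 'I_7 -> nat) k : (forall t, F t <= k) -> \sum_(t < 7) F t <= 7 * k.
Proof.
move=> h; apply: leq_trans (leq_sum _ (fun t _ => h t)) _.
by rewrite sum_nat_const card_ord.
Qed.

Section Key.

Variables (I : finType) (V : eqType) (M : I -> 'I_7 -> V).
Hypothesis inter : forall x y, exists t, M x t == M y t.
Hypothesis card_I : #|I| = 16.
Hypothesis nocov : forall vs, size vs <= 5 -> exists x, x \notin covered M vs.

Local Notation star := (star M).
Local Notation covered := (covered M).
Local Notation meet := (meet M).
Local Notation classes := (classes M).
Local Notation cov_seq := (cov_seq inter card_I nocov).

(** In this case a single vertex covers [b], [x] and [y]. *)
Definition joined (b x y : I) : bool := [exists t, (M x t == M b t) && (M y t == M b t)].

Section Blocks.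

Variables (v w : 'I_7 * I).
Let A := star v.1 v.2.
Let W := star w.1 w.2.
Let B := W :\: A.
Let C := ~: covered [:: v; w].
Hypothesis cardA : #|A| = 5.
Hypothesis cardB : 4 <= #|B|.

Let covE : covered [:: v; w] = A :|: B.
Proof. by rewrite covered_cons covered1 -/A -/W /B setDE setUIr setUCr setIT. Qed.

Let cardAB : #|A :|: B| = #|A| + #|B|.
Proof.
by rewrite cardsU setIDA setIC setDIl setDv setI0 cards0 subn0.
Qed.

Let cardB4 : #|B| = 4.
Proof.
have := @cov_bound _ _ _ inter card_I nocov [:: v; w] isT.
by rewrite covE cardAB cardA /=; move: cardB; case: #|B| => [|[|[|[|[|]]]]].
Qed.

Let cardC : #|C| = 7.
Proof.
have := cardsC (covered [:: v; w]); rewrite card_I covE cardAB cardA cardB4.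
by rewrite /C covE; lia.
Qed.

Let le2 t x : #|star t x :&: C| <= 2.
Proof.
have := @cov_star _ _ _ inter card_I nocov [:: v; w] t x C isT (disjointC_covered _ _).
by rewrite covE cardAB cardA cardB4 /=; lia.
Qed.

Let le13 t : \sum_(x in C) #|star t x :&: C| <= 13.
Proof.
have := odd_sum_star M t C; rewrite cardC.
suff : \sum_(x in C) #|star t x :&: C| <= 14 by rewrite leq_eqVlt => /orP[/eqP->|].
rewrite -[14]/(7 * 2) -cardC -sum_nat_const; apply: leq_sum => x _; exact: le2.
Qed.

(** The bound of 13 per side meets the lower bound [7 * (6 + 7)] from counting pairs of rows. Hence
    every side splits [C] into three pairs and a single row, and two rows of [C] meet exactly
    once. *)
Let sumC : \sum_(t < 7) \sum_(x in C) #|star t x :&: C| = 91.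
Proof.
apply/eqP; rewrite eqn_leq; apply/andP; split.
  exact: (@sum7_le _ 13).
by rewrite sum_star; have := sum_meet_sq inter C; rewrite cardC.
Qed.

Let eq13 t : \sum_(x in C) #|star t x :&: C| = 13.
Proof.
have := @leq_sum_eq _ xpredT (fun=> 13) (fun t => \sum_(x in C) #|star t x :&: C|).
by move=> h; rewrite -(h _ _ t) // sum_nat_const card_ord sumC.
Qed.

Let meet1 x y : x \in C -> y \in C -> x != y -> meet x y = 1.
Proof.
move=> hx hy xy.
have e : \sum_(z in C) meet x z = 13.
  apply: (@leq_sum_eq _ (fun z => z \in C) (fun x => \sum_(z in C) meet x z) (fun=> 13) _ _ x) => //.
    by move=> u hu; have := sum_meet_self inter hu; rewrite cardC.
  by rewrite -sum_star sumC sum_nat_const cardC.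
apply: (@leq_sum_eq _ (fun z => z \in C :\ x) (meet x) (fun=> 1) _ _ y); last by rewrite in_setD1 eq_sym xy.
  by move=> z _; apply: meet_gt0.
move: e; rewrite (big_setD1 x) //= meetxx sum_nat_const muln1.
by have := cardsD1 x C; rewrite hx cardC; lia.
Qed.

Let U t := [set e | star t e :&: C != set0].

(** Parts of [C] have size at most 2, where [n ^ 2 + 2 * (0 < n) = 3 * n]; the sums of sizes and of
    squares are 7 and 13. *)
Let classes4 t : count (fun c => c :&: C != set0) (classes t) = 4.
Proof.
have e1 := card_classes M t C; have e2 := eq13 t; move: e1 e2; rewrite sum_star_sq cardC.
move=> e1 e2; rewrite -sum1_count big_mkcond /=.
have : \sum_(c <- classes t) #|c :&: C| ^ 2
   + 2 * \sum_(c <- classes t) (if c :&: C != set0 then 1 else 0)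
   = 3 * \sum_(c <- classes t) #|c :&: C|.
  rewrite !big_distrr -big_split /= big_seq [RHS]big_seq.
  apply: eq_bigr => c /mem_classes[x ->].
  by rewrite -card_gt0; have := le2 t x; case: #|_| => [|[|[|]]].
by rewrite -e1 e2; move: (\sum_(c <- _) _); lia.
Qed.

(** [U t] is the union of the four classes meeting [C]; these and [vs] are at most five vertices. *)
Let boundU vs t : size vs <= 1 -> U t \subset ~: covered vs ->
  #|covered vs| + #|U t| <= 13 + (size vs).*2.
Proof.
move=> sz sub; pose cs : seq {set I} := [seq c <- classes t | c :&: C != set0].
have scs : size cs = 4 by rewrite size_filter classes4.
have subc : {subset cs <= classes t} by move=> c; rewrite mem_filter => /andP[].
have uU : \bigcup_(c <- cs) c = U t.
  apply/setP=> x; rewrite inE bigcup_seq; apply/bigcupP/idP => [[c hc xc]|hx].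
    move: (hc); rewrite mem_filter => /andP[h1 h2].
    by rewrite -(classes_star h2 xc).
  by exists (star t x); rewrite ?star_refl // mem_filter hx star_classes.
have := @cov_classes _ _ _ inter card_I nocov vs t cs (~: covered vs).
rewrite scs => h; have {}h := h _ (filter_uniq _ (classes_uniq _ _)) subc.
have {}h := h ltac:(by rewrite -[5]/(1 + 4) leq_add2r) (disjointC_covered _ _).
move: h; have <- := card_bigcup_classes (~: covered vs) (filter_uniq _ (classes_uniq _ _)) subc.
rewrite uU (setIidPl sub) doubleD; move: (_ + _); lia.
Qed.

Let AC : A :&: C = set0.
Proof. by apply/eqP; rewrite setI_eq0 disjoints_subset /C setCK covE subsetUl. Qed.

Let WC : W :&: C = set0.
Proof.
apply/eqP; rewrite setI_eq0 disjoints_subset /C setCK covered_cons covered1.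
exact: subsetUr.
Qed.

Let subU u : star u.1 u.2 :&: C = set0 -> U u.1 \subset ~: star u.1 u.2.
Proof.
move=> e; apply/subsetP=> x; rewrite !inE => h; apply: contraNneq h => ex.
rewrite -e; apply/eqP; congr (_ :&: _); apply/eqP; rewrite eq_star; exact/eqP.
Qed.

(** By [boundU] every side contributes at most 13, the side of [v] at most [15 - 5] and that of [w]
    at most [15 - 4], in total [10 + 11 + 5 * 13]. If [v] and [w] share a side, its set [U] lies in
    [C] and contributes at most 7. *)
Let sumU : \sum_(t < 7) #|U t| <= 86.
Proof.
have b13 t : #|U t| <= 13.
  have := @boundU [::] t isT; rewrite /covered big_nil cards0 setC0.
  by apply; apply: subsetT.
have bv : #|U v.1| <= 10.
  have := @boundU [:: v] v.1 isT; rewrite covered1 -/A cardA => /(_ (subU AC)).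
  by rewrite /=; lia.
have bw : #|U w.1| <= 11.
  have := @boundU [:: w] w.1 isT; rewrite covered1 -/W => /(_ (subU WC)) /=.
  have : 4 <= #|W| by rewrite -cardB4; apply/subset_leq_card/subsetDl.
  by lia.
rewrite (bigD1 v.1) //=; case: (eqVneq w.1 v.1) => [e|ne].
  have : #|U v.1| <= #|C|.
    apply: subset_leq_card; rewrite /C covered_cons covered1 setCU subsetI.
    by rewrite (subU AC) -e (subU WC).
  rewrite cardC.
  suff : \sum_(i < 7 | i != v.1) #|U i| <= 78 by move: (\sum_(i < 7 | _) _); lia.
  apply: leq_trans (leq_sum _ (fun t _ => b13 t)) _.
  by rewrite sum_nat_const cardC1 card_ord.
rewrite (bigD1 w.1) //=.
suff : \sum_(i < 7 | (i != v.1) && (i != w.1)) #|U i| <= 65.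
  by move: (\sum_(i < 7 | _) _); lia.
apply: leq_trans (leq_sum _ (fun t _ => b13 t)) _; rewrite sum_nat_const.
have hw : w.1 \in predC1 v.1 by exact: ne.
have := cardD1 w.1 (predC1 v.1); rewrite hw cardC1 card_ord => -[e].
suff -> : #|[pred i : 'I_7 | (i != v.1) && (i != w.1)]| = 5 by [].
by apply: etrans (esym e); apply: eq_card => i; rewrite !inE andbC.
Qed.

Let k e := #|[set t | star t e :&: C != set0]|.

(** [e] meets all seven rows of [C], at most two of them per side. *)
Let k_ge4 e : 4 <= k e.
Proof.
have : 7 <= \sum_(y in C) meet e y.
  by rewrite -cardC -sum1_card; apply: leq_sum => y _; apply: meet_gt0.
rewrite -sum_star1 => h; have : 7 <= 2 * k e.
  apply: leq_trans h _; rewrite mulnC /k -sum_nat_const [leqRHS]big_mkcond /=.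
  apply: leq_sum => t _; rewrite inE -card_gt0.
  by have := le2 t e; case: #|_| => [|[|]].
by move: (k e); lia.
Qed.

(** The sum in [sumU] is also the sum of [k] over all rows. Rows of [C] contribute 7 each and rows
    of [A] at least 4 each, which leaves [86 - 49 - 20] for [B]. *)
Let sum_kB : \sum_(b in B) k b <= 17.
Proof.
have e : \sum_(t < 7) #|U t| = \sum_e k e.
  transitivity (\sum_(t < 7) \sum_e (star t e :&: C != set0)).
    apply: eq_bigr => t _; rewrite -sum1_card big_mkcond /=.
    by apply: eq_bigr => i _; rewrite inE; case: ifP.
  rewrite exchange_big; apply: eq_bigr => i _; rewrite /k -sum1_card [RHS]big_mkcond /=.
  by apply: eq_bigr => t _; rewrite inE; case: ifP.
have h1 : 49 <= \sum_(i in C) k i.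
  rewrite -[49]/(7 * 7) -{1}cardC -sum_nat_const; apply: leq_sum => i hi.
  rewrite /k (_ : [set t | _] = setT) ?cardsT ?card_ord //; apply/setP=> t.
  by rewrite !in_set; apply/set0Pn; exists i; rewrite in_setI star_refl.
have h2 : 20 <= \sum_(i in A) k i.
  by rewrite -[20]/(5 * 4) -{1}cardA -sum_nat_const; apply: leq_sum => i _.
have := sumU; rewrite e.
rewrite (bigID (mem C)) /= [X in _ + X](bigID (mem A)) /=.
rewrite [X in _ + (X + _)](eq_bigl (mem A)); last first.
  by move=> i /=; rewrite /C covE in_setC negbK in_setU; case: (i \in A); rewrite ?andbF.
rewrite [X in _ + (_ + X)](eq_bigl (mem B)); last first.
  by move=> i /=; rewrite /C covE in_setC negbK in_setU in_setD; case: (i \in A); rewrite ?andbF ?andbT.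
by move: (\sum_(i in C) _) (\sum_(i in A) _) (\sum_(i in B) _) h1 h2; lia.
Qed.

(* [b] meets each of the seven rows of [C]; grouping these rows by the side on which [b] meets
   them yields a matching. *)
Let label b x : 'I_7 := xchoose (inter x b).

Let labelP b x : M x (label b x) == M b (label b x).
Proof. exact: xchooseP (inter x b). Qed.

(** The enumeration [cs] of [C] is a parameter, so that it can later be chosen to bring the first
    matching into normal form. *)
Let matching_of x0 (cs : seq I) b : uniq cs -> size cs = 7 -> {subset cs <= C} ->
  exists2 L, matching (fun i j => joined b (nth x0 cs i) (nth x0 cs j)) L
    & 7 <= size L + k b.
Proof.
move=> ucs scs sub; pose f i := label b (nth x0 cs i).
have mcs : map (nth x0 cs) (iota 0 7) = cs by rewrite -scs map_nth_iota0 // take_size.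
have [d|L [h1 h2 h3 h4]] := @matching_of_labels _ f 7 0.
  apply: leq_trans (le2 d b).
  rewrite -[count _ _](_ : count (fun y => label b y == d) cs = _); last first.
    by rewrite -[in LHS]mcs count_map.
  rewrite -size_filter -(card_uniqP (filter_uniq _ ucs)); apply/subset_leq_card/subsetP.
  by move=> x; rewrite mem_filter => /andP[/eqP<- hx]; rewrite in_setI sub // mem_star labelP.
exists L.
  apply/and3P; split=> //.
    apply/allP=> p /(allP h2) /and4P[_ -> -> /eqP e] /=.
    apply/existsP; exists (f p.1); rewrite labelP /= e; exact: labelP.
  move: h3; rewrite uniq_pairwise pairwise_map.
  apply: (@sub_in_pairwise _ (mem L)); last by apply/allP=> p.
  move=> p q hp hq /=; have /and4P[_ _ _ /eqP ep] := allP h2 p hp.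
  have /and4P[_ _ _ /eqP eq] := allP h2 q hq.
  rewrite disj2E => ne; apply/and4P; split; apply: contraNneq ne => e.
  - by rewrite e.
  - by rewrite e eq.
  - by rewrite ep e.
  - by rewrite ep eq e.
apply: leq_trans h1 _; rewrite leq_add2l -(card_uniqP (undup_uniq _)).
apply/subset_leq_card/subsetP=> t; rewrite mem_undup => /mapP[i hi ->].
rewrite inE; apply/set0Pn; exists (nth x0 cs i); rewrite in_setI mem_star labelP.
by rewrite sub // mem_nth // scs; move: hi; rewrite mem_iota.
Qed.

Let bAC b : b \in B -> b \notin A /\ b \notin C.
Proof. by rewrite /C covE !inE => /andP[-> ->]; rewrite orbT. Qed.

Let uniq_blocks (bs cs : seq I) : uniq bs -> uniq cs -> {subset bs <= B} ->
  {subset cs <= C} -> uniq (enum A ++ bs ++ cs).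
Proof.
move=> ub uc sb sc; rewrite !cat_uniq enum_uniq ub uc /= andbT.
apply/andP; split.
  apply/hasPn=> x; rewrite mem_cat mem_enum => /orP[/sb/bAC[]//|/sc hx].
  apply/negP=> hA; have : x \in A :&: C by rewrite inE hA hx.
  by rewrite AC inE.
by apply/hasPn=> x /sc hx; apply/negP=> /sb/bAC[]; rewrite hx.
Qed.

(** [v] and the three joining vertices would cover [5 + 3 + 6 = 14] rows, against [5 + 2 * 4] in
    [cov_bound]. *)
Let no_rainbow b1 b2 b3 x1 y1 x2 y2 x3 y3 :
  uniq [:: b1; b2; b3] -> {subset [:: b1; b2; b3] <= B} ->
  uniq [:: x1; y1; x2; y2; x3; y3] -> {subset [:: x1; y1; x2; y2; x3; y3] <= C} ->
  joined b1 x1 y1 -> joined b2 x2 y2 -> joined b3 x3 y3 -> False.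
Proof.
move=> ub sb uc sc /existsP[t1 /andP[h1 g1]] /existsP[t2 /andP[h2 g2]].
move=> /existsP[t3 /andP[h3 g3]].
have := @cov_seq [:: v; (t1, b1); (t2, b2); (t3, b3)] _ isT (uniq_blocks ub uc sb sc).
rewrite size_cat -cardE cardA /= => h; apply: notF; apply: h => z.
rewrite !covered_cons !in_setU mem_cat mem_enum /= -/A !mem_star.
rewrite !inE => /orP[->//|].
repeat case/orP; move/eqP->; by rewrite ?eqxx ?h1 ?g1 ?h2 ?g2 ?h3 ?g3 ?orbT.
Qed.

(** Rows [x1] and [y1] meet only once, so [b1] and [b2] join them at the same vertex. Three vertices
    would then cover [5 + 3 + 4 = 12] rows, against [5 + 2 * 3]. *)
Let no_repeat b1 b2 b3 x1 y1 x2 y2 :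
  uniq [:: b1; b2; b3] -> {subset [:: b1; b2; b3] <= B} ->
  uniq [:: x1; y1; x2; y2] -> {subset [:: x1; y1; x2; y2] <= C} ->
  joined b1 x1 y1 -> joined b2 x1 y1 -> joined b3 x2 y2 -> False.
Proof.
move=> ub sb uc sc /existsP[t1 /andP[h1 g1]] /existsP[t2 /andP[h2 g2]].
move=> /existsP[t3 /andP[h3 g3]].
have e : t1 = t2.
  have hx : x1 \in C by apply: sc; rewrite !inE eqxx.
  have hy : y1 \in C by apply: sc; rewrite !inE eqxx !orbT.
  have ne : x1 != y1 by move: uc; rewrite /= !inE !negb_or => /andP[/andP[]].
  have /eqP := meet1 hx hy ne; rewrite /meet => /cards1P[t et].
  have i1 : t1 \in [set t] by rewrite -et inE (eqP h1) (eqP g1).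
  have i2 : t2 \in [set t] by rewrite -et inE (eqP h2) (eqP g2).
  by move: i1 i2; rewrite !inE => /eqP-> /eqP->.
have b21 : M b2 t1 == M b1 t1 by rewrite e -(eqP h2) -e (eqP h1).
have := @cov_seq [:: v; (t1, b1); (t3, b3)] _ isT (uniq_blocks ub uc sb sc).
rewrite size_cat -cardE cardA /= => h; apply: notF; apply: h => z.
rewrite !covered_cons !in_setU mem_cat mem_enum /= -/A !mem_star.
rewrite !inE => /orP[->//|].
repeat case/orP; move/eqP->; by rewrite ?eqxx ?b21 ?h1 ?g1 ?h3 ?g3 ?orbT.
Qed.

Let unobstructed x0 (cs : seq I) b1 b2 b3 m1 m2 m3 :
  uniq cs -> size cs = 7 -> {subset cs <= C} ->
  uniq [:: b1; b2; b3] -> {subset [:: b1; b2; b3] <= B} ->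
  let ok b p := [&& p.1 < p.2, p.2 < 7 & joined b (nth x0 cs p.1) (nth x0 cs p.2)] in
  all (ok b1) m1 -> all (ok b2) m2 -> all (ok b3) m3 -> ~~ obstructed m1 m2 m3.
Proof.
move=> ucs scs sub ub sb ok a1 a2 a3.
have okn b p : ok b p -> [/\ p.1 != p.2, p.1 < 7 & p.2 < 7].
  by case/and3P=> lt lt7 _; split=> //; [rewrite ltn_eqF | apply: ltn_trans lt lt7].
have okj b p : ok b p -> joined b (nth x0 cs p.1) (nth x0 cs p.2) by case/and3P.
have un (l : seq nat) : all (fun i => i < 7) l -> uniq l ->
    uniq (map (nth x0 cs) l) /\ {subset map (nth x0 cs) l <= C}.
  move=> /allP hl ul; split.
    rewrite map_inj_in_uniq // => i j /hl hi /hl hj /eqP.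
    by rewrite nth_uniq ?scs // => /eqP.
  by move=> x /mapP[i /hl hi ->]; apply: sub; rewrite mem_nth ?scs.
have rep b b' b'' m m' m'' : uniq [:: b; b'; b''] -> {subset [:: b; b'; b''] <= B} ->
    all (ok b) m -> all (ok b') m' -> all (ok b'') m'' -> repeated m m' m'' = false.
  move=> ub' sb' /allP h /allP h' /allP h''; rewrite /repeated exists_inE; apply/hasP.
  case=> p hp; rewrite !exists_inE has_pred1; case: ifP => // /h' o' /hasP[q /h'' o'' d].
  have o := h p hp; have [n1 l1 l2] := okn _ _ o; have [n2 l3 l4] := okn _ _ o''.
  have [||u s] := un [:: p.1; p.2; q.1; q.2].
  - by rewrite /= l1 l2 l3 l4.
  - move: d; rewrite disj2E => /and4P[d1 d2 d3 d4].
    by rewrite /= !inE !negb_or n1 n2 d1 d2 d3 d4.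
  exact: (no_repeat ub' sb' u s (okj _ _ o) (okj _ _ o') (okj _ _ o'')).
have rot3 (a b c : I) : uniq [:: a; b; c] -> uniq [:: a; c; b] /\ uniq [:: b; c; a].
  rewrite /= !inE !negb_or !andbT => /andP[/andP[ab ac] bc].
  by rewrite ab ac bc (eq_sym c b) bc (eq_sym b a) ab (eq_sym c a) ac.
have [ub' ub''] := rot3 _ _ _ ub.
rewrite /obstructed (rep b1 b2 b3) // (rep b1 b3 b2) ?(rep b2 b3 b1) //; last 2 first.
- by move=> z hz; apply: sb; move: hz; rewrite !inE => /or3P[]->; rewrite ?orbT.
- by move=> z hz; apply: sb; move: hz; rewrite !inE => /or3P[]->; rewrite ?orbT.
case: ifP => //; rewrite /rainbow exists_inE => /hasP[p /(allP a1) o1].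
rewrite exists_inE => /hasP[q /(allP a2) o2]; case: ifP => // d12.
rewrite exists_inE => /hasP[r /(allP a3) o3]; case: ifP => // d13 d23.
have [n1 l1 l1'] := okn _ _ o1; have [n2 l2 l2'] := okn _ _ o2.
have [n3 l3 l3'] := okn _ _ o3.
have [||u s] := un [:: p.1; p.2; q.1; q.2; r.1; r.2].
- by rewrite /= l1 l2 l3 l1' l2' l3'.
- move: d12 d13 d23; rewrite !disj2E => /and4P[e1 e2 e3 e4] /and4P[e5 e6 e7 e8].
  by case/and4P=> e9 e10 e11 e12; rewrite /= !inE !negb_or n1 n2 n3 e1 e2 e3 e4 e5 e6 e7 e8 e9 e10 e11 e12.
by case: (no_rainbow ub sb u s (okj _ _ o1) (okj _ _ o2) (okj _ _ o3)).
Qed.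

Lemma no_blocks : False.
Proof.
pose s := sort (fun a b => k a <= k b) (enum B).
have ps : perm_eq s (enum B) by rewrite perm_sort.
have us : uniq s by rewrite sort_uniq enum_uniq.
have ss : size s = 4 by rewrite size_sort -cardE.
have sB : {subset s <= B} by move=> b; rewrite mem_sort mem_enum.
have sok : sorted (fun a b => k a <= k b) s.
  by apply: sort_sorted => a b; apply: leq_total.
have sumk : \sum_(b <- s) k b <= 17 by rewrite (perm_big _ ps) /= big_enum.
move: s ss us sB sok sumk {ps} => [|b1 [|b2 [|b3 [|b4 [|]]]]] // _ us sB /=.
rewrite !big_cons big_nil andbT => /and3P[k12 k23 k34] sumk.
(* Four increasing values, each at least 4, with sum at most 17. *)
have [e1 e2 e3 e4] : [/\ k b1 = 4, k b2 = 4, k b3 = 4 & k b4 <= 5].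
  have := k_ge4 b1; have := k_ge4 b2; have := k_ge4 b3; have := k_ge4 b4.
  by move: (k b1) (k b2) (k b3) (k b4) k12 k23 k34 sumk => ? ? ? ? *; split; lia.
have [||| L1 /and3P[a1 a2 a3] s1] := @matching_of b1 (enum C) b1.
- exact: enum_uniq.
- by rewrite -cardE.
- by move=> x; rewrite mem_enum.
have {}s1 : 3 <= size L1 by move: s1; rewrite e1; case: (size L1) => [|[|[|]]].
case: L1 s1 a1 a2 a3 => [|p [|q [|r L1]]] //= _.
move=> /and4P[/and3P[p1 p2 p3] /and3P[q1 q2 q3] /and3P[r1 r2 r3] _].
rewrite !disj2E => /andP[/and3P[d1 d2 _] /andP[/andP[d3 _] _]] _.
pose g := nth b1 (enum C).
pose six := map g [:: p.1; p.2; q.1; q.2; r.1; r.2].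
have us6 : uniq six.
  rewrite map_inj_in_uniq; last first.
    have lt i : i \in [:: p.1; p.2; q.1; q.2; r.1; r.2] -> i < size (enum C).
      rewrite -cardE cardC !inE.
      by repeat case/orP; move/eqP-> => //; [apply: ltn_trans p2 | apply: ltn_trans q2 | apply: ltn_trans r2].
    by move=> i j /lt hi /lt hj /eqP; rewrite nth_uniq ?enum_uniq // => /eqP.
  case/and4P: d1 => f1 f2 f3 f4; case/and4P: d2 => f5 f6 f7 f8.
  case/and4P: d3 => f9 f10 f11 f12; rewrite /= !inE !negb_or (ltn_eqF p1).
  by rewrite (ltn_eqF q1) (ltn_eqF r1) f1 f2 f3 f4 f5 f6 f7 f8 f9 f10 f11 f12.
have s6 : {subset six <= C}.
  move=> x /mapP[i hi ->]; rewrite /g -mem_enum mem_nth // -cardE cardC.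
  move: hi; rewrite !inE.
  by repeat case/orP; move/eqP-> => //; [apply: ltn_trans p2 | apply: ltn_trans q2 | apply: ltn_trans r2].
(* In this order of [C] the three pairs of [b1] become [matching1]. *)
pose cs := six ++ enum (C :\: [set x in six]).
have ucs : uniq cs.
  rewrite cat_uniq us6 enum_uniq andbT; apply/hasPn=> x.
  by rewrite mem_enum !inE => /andP[].
have scs : size cs = 7.
  rewrite size_cat -cardE cardsD (setIidPr _) ?cardC ?cardsE ?(card_uniqP us6) //.
  by apply/subsetP=> x; rewrite inE; apply: s6.
have subcs : {subset cs <= C}.
  by move=> x; rewrite mem_cat mem_enum => /orP[/s6//|]; rewrite inE => /andP[].
pose x0 := b1.
have m1 : all (fun p => [&& p.1 < p.2, p.2 < 7 & joined b1 (nth x0 cs p.1) (nth x0 cs p.2)])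
   [:: (0, 1); (2, 3); (4, 5)] by rewrite /= p3 q3 r3.
have tk (b : I) n L : n <= size L ->
    matching (fun i j => joined b (nth x0 cs i) (nth x0 cs j)) L ->
    exists2 m, matching (fun i j => joined b (nth x0 cs i) (nth x0 cs j)) m & size m = n.
  move=> hn /and3P[h1 h2 h3]; exists (take n L); last exact: size_takel.
  have sL : subseq (take n L) L by apply: take_subseq.
  apply/and3P; split; first by apply/allP=> z /mem_take; apply: (allP h1).
    exact: subseq_pairwise sL h2.
  by apply: (subseq_sorted ltn_trans _ h3); apply: map_subseq.
have [L2 h2 s2] := matching_of x0 b2 ucs scs subcs.
have [L3 h3 s3] := matching_of x0 b3 ucs scs subcs.
have [L4 h4 s4] := matching_of x0 b4 ucs scs subcs.
have [|m2 m2P z2] := tk b2 3 L2 _ h2; first by move: s2; rewrite e2; case: (size L2) => [|[|[|]]].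
have [|m3 m3P z3] := tk b3 3 L3 _ h3; first by move: s3; rewrite e3; case: (size L3) => [|[|[|]]].
have [|m4 m4P z4] := tk b4 1 L4 _ h4.
  by have := leq_trans s4 (leq_add (leqnn _) e4); case: (size L4).
have allm m b : matching (fun i j => joined b (nth x0 cs i) (nth x0 cs j)) m ->
    all (fun p => [&& p.1 < p.2, p.2 < 7 & joined b (nth x0 cs p.1) (nth x0 cs p.2)]) (rev m).
  by case/and3P; rewrite all_rev.
have us4 : [/\ uniq [:: b1; b2; b3], uniq [:: b1; b2; b4], uniq [:: b1; b3; b4]
    & uniq [:: b2; b3; b4]].
  by move: us; rewrite /= !inE !negb_or !andbT => /and3P[/and3P[-> -> ->] /andP[-> ->] ->].
case: us4 => u123 u124 u134 u234.
have sub4 (l : seq I) : {subset l <= [:: b1; b2; b3; b4]} -> {subset l <= B}.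
  by move=> h z /h; apply: sB.
have no b b' b'' m m' m'' : uniq [:: b; b'; b''] ->
    all (mem [:: b1; b2; b3; b4]) [:: b; b'; b''] ->
    all (fun p => [&& p.1 < p.2, p.2 < 7 & joined b (nth x0 cs p.1) (nth x0 cs p.2)]) m ->
    all (fun p => [&& p.1 < p.2, p.2 < 7 & joined b' (nth x0 cs p.1) (nth x0 cs p.2)]) m' ->
    all (fun p => [&& p.1 < p.2, p.2 < 7 & joined b'' (nth x0 cs p.1) (nth x0 cs p.2)]) m'' ->
    obstructed m m' m'' = false.
  move=> u /allP sb a a' a''; apply: negbTE.
  by apply: (unobstructed ucs scs subcs u _ a a' a''); apply: sub4.
have c2 := allm _ _ m2P; have c3 := allm _ _ m3P; have c4 := allm _ _ m4P.
have in4 b b' b'' : b \in [:: b1; b2; b3; b4] -> b' \in [:: b1; b2; b3; b4] ->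
    b'' \in [:: b1; b2; b3; b4] -> all (mem [:: b1; b2; b3; b4]) [:: b; b'; b''].
  by move=> h h' h''; rewrite /= h h' h''.
have [i1 i2 i3 i4] : [/\ b1 \in [:: b1; b2; b3; b4], b2 \in [:: b1; b2; b3; b4],
    b3 \in [:: b1; b2; b3; b4] & b4 \in [:: b1; b2; b3; b4]].
  by rewrite !inE !eqxx !orbT.
case: (matchings_obstructed m2P z2 m3P z3 m4P z4).
  by rewrite (no _ _ _ _ _ _ u123 (in4 _ _ _ i1 i2 i3) m1 c2 c3).
rewrite /check_edge (no _ _ _ _ _ _ u124 (in4 _ _ _ i1 i2 i4) m1 c2 c4).
rewrite (no _ _ _ _ _ _ u134 (in4 _ _ _ i1 i3 i4) m1 c3 c4).
by rewrite (no _ _ _ _ _ _ u234 (in4 _ _ _ i2 i3 i4) c2 c3 c4).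
Qed.

End Blocks.

Lemma star_diff_le3 v w : #|star v.1 v.2| = 5 -> #|star w.1 w.2 :\: star v.1 v.2| <= 3.
Proof. by move=> h; rewrite leqNgt; apply/negP => /(no_blocks h). Qed.

End Key.

(** * Class sizes on one side *)

(** Scanning only lists that decrease in this order visits each multiset of profiles once. *)
Definition pair_ge (a b : nat * nat) : bool :=
  (b.1 + b.2 < a.1 + a.2) || ((b.1 + b.2 == a.1 + a.2) && (b.1 <= a.1)).

(** [R] and [N] are the totals still to be distributed and [acc] is the choice so far, reversed. A
    choice failing [ok] prunes its branch, while exhausting the fuel [n] counts as failure. *)
Fixpoint scan (ok fin : seq (nat * nat) -> bool) (opts : seq (nat * nat))
    (n : nat) (acc : seq (nat * nat)) (R N : nat) : bool :=
  if n is n'.+1 then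
    if ok acc then
      if (R == 0) && (N == 0) then fin acc
      else all (fun o =>
        if [&& o.1 <= R, o.2 <= N & (if acc is a :: _ then pair_ge a o else true)]
        then scan ok fin opts n' (o :: acc) (R - o.1) (N - o.2) else true) opts
    else true
  else false.

Lemma scanP ok fin opts n acc R N p :
  scan ok fin opts n acc R N -> all (mem opts) p -> (0, 0) \notin p ->
  (if acc is a :: _ then path pair_ge a p else sorted pair_ge p) ->
  \sum_(o <- p) o.1 = R -> \sum_(o <- p) o.2 = N ->
  (forall k, ok (catrev (take k p) acc)) -> fin (catrev p acc).
Proof.
elim: n acc R N p => //= n IH acc R N p.
case: ifP => [_|oka]; last by move=> _ _ _ _ _ _ /(_ 0); rewrite take0 /= oka.
case: p => [|o p].
  by move=> h _ _ _; rewrite !big_nil => eR eN _; move: h; rewrite -eR -eN.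
rewrite /= inE negb_or !big_cons => h /andP[ho hp] /andP[o0 p0] so eR eN hok.
have nz : (R == 0) && (N == 0) = false.
  apply: contraNF o0; rewrite -eR -eN !addn_eq0 => /andP[/andP[/eqP e1 _] /andP[/eqP e2 _]].
  by rewrite eq_sym [o]surjective_pairing e1 e2.
move: h; rewrite nz => /allP/(_ o ho).
have -> : o.1 <= R by rewrite -eR leq_addr.
have -> : o.2 <= N by rewrite -eN leq_addr.
have -> : (if acc is a :: _ then pair_ge a o else true) = true.
  by case: acc so {hok IH} => // a acc /andP[].
move=> h; apply: (IH _ _ _ p h) => //; last by move=> k; have := hok k.+1.
- by case: acc so {hok IH h} => [|a acc] //= /andP[].
- by rewrite -eR addKn.
- by rewrite -eN addKn.
Qed.

Lemma pair_ge_total : total pair_ge.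
Proof. by move=> [a b] [c d]; rewrite /pair_ge /=; lia. Qed.

Section Sides.

Variables (I : finType) (V : eqType) (M : I -> 'I_7 -> V).
Local Notation classes := (classes M).

Definition profile (X Y : {set I}) (c : {set I}) : nat * nat := (#|c :&: X|, #|c :&: Y|).

(** The profiles of the classes, sorted by [pair_ge], form one of the scanned lists. The hypothesis
    on [ok] concerns all lists of distinct classes and so applies to the reversed prefixes met by
    the scan. *)
Lemma side_scan t (X Y : {set I}) ok fin opts :
  X :|: Y = setT ->
  scan ok fin opts 17 [::] #|X| #|Y| ->
  (forall c, c \in classes t -> profile X Y c \in opts) ->
  (forall cs, uniq cs -> {subset cs <= classes t} -> ok (map (profile X Y) cs)) ->
  exists2 cs, perm_eq cs (classes t) & fin (rev (map (profile X Y) cs)).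
Proof.
move=> XY hs ho hok.
pose cs := sort (fun c d => pair_ge (profile X Y c) (profile X Y d)) (classes t).
have pc : perm_eq cs (classes t) by rewrite perm_sort.
exists cs => //; rewrite -[rev _]/(catrev _ [::]).
apply: (scanP hs).
- apply/allP=> o /mapP[c hc ->]; apply: ho.
  by rewrite -(perm_mem pc).
- apply/negP=> /mapP[c]; rewrite (perm_mem pc) => /mem_classes[x ->] [/esym/eqP].
  rewrite cards_eq0 => /eqP e1 /esym/eqP; rewrite cards_eq0 => /eqP e2.
  have : x \in star M t x :&: (X :|: Y) by rewrite XY setIT star_refl.
  by rewrite setIUr e1 e2 setU0 inE.
- by rewrite sorted_map; apply: sort_sorted => c d; apply: pair_ge_total.
- by rewrite big_map (perm_big _ pc) -card_classes.
- by rewrite big_map (perm_big _ pc) -card_classes.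
move=> k; rewrite -map_take -[catrev _ _]/(rev _) -map_rev; apply: hok.
  by rewrite rev_uniq take_uniq // sort_uniq classes_uniq.
by move=> c; rewrite mem_rev => /mem_take; rewrite (perm_mem pc).
Qed.

End Sides.

Definition psize (o : nat * nat) : nat := o.1 + o.2.

(** This is [cov_bound] for vertices on one side. *)
Definition ok_prefix (l : seq (nat * nat)) : bool :=
  if size l <= 5 then sumn (map psize l) <= 5 + (size l).*2 else true.

(** The two further conditions come from [count_rest3] and from [star_diff_le3] applied to two
    disjoint classes of the side. *)
Definition ok_side (l : seq (nat * nat)) : bool :=
  [&& ok_prefix l, count (fun o => o.1 == 3) l <= 2 &
      (if has (fun o => psize o == 5) l then count (fun o => 4 <= psize o) l <= 1 else true)].

Definition sq1 (l : seq (nat * nat)) : nat := sumn [seq o.1 * o.1 | o <- l].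

Definition cross (l : seq (nat * nat)) : nat := sumn [seq o.1 * o.2 | o <- l].

(* Class sizes [(|c :&: R|, |c :&: A|)] on a side that does not contain the vertex with
   star [A] and attains the maximal number of pairs: those with [sq1 = 27], and the only other one
   ([bad_profile]) in which fewer than two classes meet [R] in three rows. *)
Definition good_profiles : seq (seq (nat * nat)) :=
  [:: [:: (3, 2); (3, 0); (2, 1); (2, 0); (1, 1); (0, 1)];
      [:: (3, 1); (3, 1); (2, 1); (2, 0); (1, 1); (0, 1)]].

Definition bad_profile : seq (nat * nat) :=
  [:: (3, 2); (2, 1); (2, 1); (2, 0); (2, 0); (0, 1)].

(** With eleven rows outside [A], [w] is 11 plus twice the number of pairs of rows, not both in [A],
    that meet on the side. So 45 stands for 17 pairs, and 27, with [cross l = 0], for 8. *)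
Definition fin_side (l : seq (nat * nat)) : bool :=
  let w := sq1 l + (cross l).*2 in
  [&& sq1 l <= 27, w <= 45,
      (if sq1 l == 27 then count (fun o => o.1 == 3) l == 2 else true) &
      (if (w == 45) && (25 <= sq1 l) then
         [|| (sq1 l == 27) && (rev l \in good_profiles),
             (sq1 l == 25) && (rev l == bad_profile)
           | (sq1 l == 25) && (count (fun o => o.1 == 3) l == 2)] else true)].

Definition side_opts : seq (nat * nat) :=
  [seq o <- [seq (r, n) | r <- iota 0 4, n <- iota 0 6] | 0 < psize o <= 5].

(** Sixteen rows form at most sixteen nonempty classes, and one more step closes the list; hence the
    fuel 17. *)
Lemma scan_side : scan ok_side fin_side side_opts 17 [::] 11 5.
Proof. by vm_compute. Qed.

Definition fin_low (l : seq (nat * nat)) : bool := sq1 l <= 50.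

Definition low_opts : seq (nat * nat) := [:: (1, 0); (2, 0); (3, 0); (4, 0)].

(** This serves the case of maximum degree at most 4. The second set is empty, so class sizes are
    first components. *)
Lemma scan_low : scan ok_prefix fin_low low_opts 17 [::] 16 0.
Proof. by vm_compute. Qed.

(** * The equality case *)

Section Equality.

Variables (I : finType) (V : eqType) (M : I -> 'I_7 -> V).
Hypothesis inter : forall x y, exists t, M x t == M y t.
Hypothesis card_I : #|I| = 16.
Hypothesis nocov : forall vs, size vs <= 5 -> exists x, x \notin covered M vs.

Local Notation star := (star M).
Local Notation covered := (covered M).
Local Notation meet := (meet M).
Local Notation classes := (classes M).

Lemma sq1_profile t (X Y : {set I}) cs : perm_eq cs (classes t) ->
  sq1 (rev (map (profile X Y) cs)) = \sum_(x in X) #|star t x :&: X|.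
Proof.
move=> pc; rewrite /sq1 map_rev sumn_rev sumnE !big_map (perm_big _ pc) /=.
by rewrite (sum_classes M t X (fun c => #|c :&: X|)).
Qed.

Lemma cross_profile t (X Y : {set I}) cs : perm_eq cs (classes t) ->
  cross (rev (map (profile X Y) cs)) = \sum_(x in X) #|star t x :&: Y|.
Proof.
move=> pc; rewrite /cross map_rev sumn_rev sumnE !big_map (perm_big _ pc) /=.
by rewrite (sum_classes M t X (fun c => #|c :&: Y|)).
Qed.

Lemma psize_profile (X Y c : {set I}) : X :|: Y = setT -> X :&: Y = set0 ->
  psize (profile X Y c) = #|c|.
Proof.
move=> XY XY0; rewrite /psize /profile /= -cardsUI -setIUr XY setIT.
by rewrite setIACA setIid XY0 setI0 cards0 addn0.
Qed.

Lemma ok_prefix_classes t (X Y : {set I}) cs : X :|: Y = setT -> X :&: Y = set0 ->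
  uniq cs -> {subset cs <= classes t} -> ok_prefix (map (profile X Y) cs).
Proof.
move=> XY XY0 us sub; rewrite /ok_prefix size_map; case: ifP => // sz.
have := @cov_classes _ _ _ inter card_I nocov [::] t cs setT.
rewrite /= add0n => /(_ sz us sub).
rewrite {1}/covered big_nil disjoint_sym disjoints_subset sub0set => /(_ isT).
rewrite {1}/covered big_nil cards0 add0n; apply: leq_trans.
rewrite -map_comp sumnE big_map; apply: leq_sum => c _.
by rewrite /= psize_profile // setIT.
Qed.

(** With all degrees at most 4 the sides total at most [7 * 50 = 350], short of [16 * 22 = 352]. *)
Lemma exists_degree5 : exists v, #|star v.1 v.2| == 5.
Proof.
case: (boolP [exists v : 'I_7 * I, #|star v.1 v.2| == 5]) => [/existsP//|].
rewrite negb_exists => /forallP h.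
have le4 t x : #|star t x| <= 4.
  by have := star_le5 inter card_I nocov t x; have := h (t, x) => /=; lia.
have := sum_meet_sq inter [set: I]; rewrite cardsT card_I -sum_star => h2.
suff h1 : \sum_(t < 7) \sum_(x in setT) #|star t x :&: [set: I]| <= 7 * 50.
  by have := leq_trans h2 h1.
apply: sum7_le => t.
have [||||cs pc] := @side_scan _ _ M t setT set0 ok_prefix fin_low low_opts.
- by rewrite setU0.
- by rewrite cardsT card_I cards0 scan_low.
- move=> c /mem_classes[x ->]; rewrite /profile setIT setI0 cards0.
  have : 0 < #|star t x| by apply/card_gt0P; exists x; apply: star_refl.
  by have := le4 t x; case: #|_| => [|[|[|[|[|]]]]].
- by move=> cs us sub; apply: (ok_prefix_classes _ _ us sub); rewrite ?setU0 ?setI0.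
by rewrite /fin_low (sq1_profile _ _ pc).
Qed.

Section Vertex.

Variable v : 'I_7 * I.
Local Notation A := (star v.1 v.2).
Local Notation R := (~: star v.1 v.2).
Hypothesis cardA : #|A| = 5.

Let cardR : #|R| = 11.
Proof. by have := cardsC A; rewrite card_I cardA; lia. Qed.

Let RA : R :|: A = setT. Proof. by rewrite setUC setUCr. Qed.
Let RA0 : R :&: A = set0. Proof. by rewrite setIC setICr. Qed.

Let disjR : [disjoint R & covered [:: v]].
Proof. by rewrite covered1 -setI_eq0 RA0. Qed.

Lemma rest_le3 t x : #|star t x :&: R| <= 3.
Proof. by rewrite -setDE; apply: (star_diff_le3 inter card_I nocov (t, x) cardA). Qed.

Lemma count_rest3 t : count (fun c => #|c :&: R| == 3) (classes t) <= 2.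
Proof.
apply: (@count_classes _ _ _ inter card_I nocov [:: v] t R 3) => //.
  by move=> c _ /eqP->.
by rewrite covered1 cardA.
Qed.

Lemma side_profile t : exists2 cs, perm_eq cs (classes t)
  & fin_side (rev (map (profile R A) cs)).
Proof.
apply: (side_scan RA (ok := ok_side) (opts := side_opts)); first by rewrite cardR cardA scan_side.
  move=> c /mem_classes[x ->]; rewrite mem_filter psize_profile // star_le5 // andbT.
  have -> : 0 < #|star t x| by apply/card_gt0P; exists x; apply: star_refl.
  rewrite /profile; apply: allpairs_f; rewrite mem_iota /= ltnS ?rest_le3 //.
  by apply: leq_trans (star_le5 inter card_I nocov t x); apply/subset_leq_card/subsetIl.
move=> cs us sub; rewrite /ok_side (ok_prefix_classes RA RA0 us sub) /=.
rewrite !count_map has_map.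
have -> : count (preim (profile R A) (fun o => o.1 == 3)) cs <= 2.
  apply: leq_trans (count_rest3 t); rewrite -!size_filter.
  apply: uniq_leq_size; first exact: filter_uniq.
  by move=> c; rewrite mem_filter => /andP[h /sub hc]; rewrite mem_filter hc andbT.
(* A class of five rows and another of at least four on the same side are disjoint, contrary to
   [star_diff_le3]. *)
case: ifP => // /hasP[c hc /=]; rewrite psize_profile // => /eqP c5.
rewrite leqNgt; apply/negP; rewrite -size_filter => hlt.
pose s := [seq d <- cs | preim (profile R A) (fun o => 4 <= psize o) d].
have [d hd dc] : exists2 d, d \in s & d != c.
  have us' : uniq s by apply: filter_uniq.
  case es : s us' hlt => [|a [|b l]] //; rewrite -/s es //= inE negb_or.
  move=> /andP[/andP[ab _] _] _; case: (eqVneq a c) => [e|ne].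
    by exists b; [rewrite !inE eqxx orbT | rewrite -e eq_sym].
  by exists a; rewrite // inE eqxx.
move: hd; rewrite mem_filter /= psize_profile // => /andP[d4 hd].
have [x ec] := mem_classes M t c (sub _ hc); have [y ed] := mem_classes M t d (sub _ hd).
have := @star_diff_le3 _ _ _ inter card_I nocov (t, x) (t, y).
rewrite /= -ec -ed => /(_ c5); rewrite cardsD [d :&: c](_ : _ = set0) ?cards0 ?subn0; first lia.
apply/setP=> z; rewrite !inE; apply/negP=> /andP[zd zc]; case/negP: dc.
by rewrite (classes_star (sub _ hc) zc) (classes_star (sub _ hd) zd).
Qed.

Let sq t := \sum_(x in R) #|star t x :&: R|.
Let cr t := \sum_(x in R) #|star t x :&: A|.

Let sqE t cs : perm_eq cs (classes t) -> sq1 (rev (map (profile R A) cs)) = sq t.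
Proof. exact: sq1_profile. Qed.

Let crE t cs : perm_eq cs (classes t) -> cross (rev (map (profile R A) cs)) = cr t.
Proof. exact: cross_profile. Qed.

Let sq_le t : sq t <= 27.
Proof. by have [cs pc /and4P[]] := side_profile t; rewrite (sqE pc). Qed.

Let w_le t : sq t + (cr t).*2 <= 45.
Proof. by have [cs pc /and4P[_ + _ _]] := side_profile t; rewrite (sqE pc) (crE pc). Qed.

Let cr_v : cr v.1 = 0.
Proof.
apply: big1 => x; rewrite inE => hx; apply/eqP; rewrite cards_eq0 setI_eq0.
apply/pred0P=> y /=; apply/negP=> /andP[]; rewrite !mem_star => /eqP e1 /eqP e2.
by case/negP: hx; rewrite mem_star -e1 e2.
Qed.

Let sum_sq_ge : 187 <= \sum_(t < 7) sq t.
Proof. by rewrite sum_star; have := sum_meet_sq inter R; rewrite cardR. Qed.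

Let sum_cr_ge : 55 <= \sum_(t < 7) cr t.
Proof. by rewrite sum_star; have := sum_meet_ge inter R A; rewrite cardR cardA. Qed.

Let w t := sq t + (cr t).*2.
Let bound t := if t == v.1 then 27 else 45.

Let w_bound t : w t <= bound t.
Proof.
rewrite /w /bound; case: eqP => [->|_]; last exact: w_le.
by rewrite cr_v addn0.
Qed.

Let sum_bound : \sum_(t < 7) bound t = 297.
Proof.
rewrite (bigD1 v.1) //= /bound eqxx (eq_bigr (fun=> 45)).
  by rewrite sum_nat_const cardC1 card_ord.
by move=> t /negPf->.
Qed.

Let sum_w : \sum_(t < 7) w t = \sum_(t < 7) sq t + (\sum_(t < 7) cr t).*2.
Proof.
rewrite big_split /=; congr (_ + _); rewrite -mul2n big_distrr /=.
by apply: eq_bigr => t _; rewrite mul2n.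
Qed.

Let sum_w_le : \sum_(t < 7) w t <= 297.
Proof. by rewrite -sum_bound; apply: leq_sum => t _. Qed.

(** The lower bounds give [187 + 2 * 55 = 297], exactly the total of [bound], so all these
    inequalities are equalities. *)
Let sums : \sum_(t < 7) sq t = 187 /\ \sum_(t < 7) cr t = 55.
Proof.
move: sum_w_le sum_sq_ge sum_cr_ge; rewrite sum_w.
by move: (\sum_(t < 7) sq t) (\sum_(t < 7) cr t); clear; lia.
Qed.

Let w_eq t : w t = bound t.
Proof.
have := @leq_sum_eq _ xpredT bound w (fun t _ => w_bound t).
rewrite sum_bound sum_w; case: sums => -> -> /(_ isT t isT) //.
Qed.

(** The other six sides contribute at most 27 each, and [187 - 6 * 27 = 25]. *)
Let sq_ge t : 25 <= sq t.
Proof.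
case: sums => e _; move: e; rewrite (bigD1 t) //= => e.
have : \sum_(i < 7 | i != t) sq i <= 162.
  apply: leq_trans (leq_sum _ (fun i _ => sq_le i)) _.
  by rewrite sum_nat_const cardC1 card_ord.
by move: e; move: (sq t) (\sum_(i < 7 | _) _); clear; lia.
Qed.

(** The totals in [sums] are the least possible ones, [11 * 17] and [11 * 5], so no single term
    exceeds its minimum. *)
Lemma rest_meet1 x y : x \in R -> x != y -> meet x y = 1.
Proof.
move=> hx xy; case: sums; rewrite /sq /cr !sum_star => e1 e2.
case: (boolP (y \in A)) => hy.
  have e : \sum_(z in A) meet x z = 5.
    apply: (@leq_sum_eq _ (fun z => z \in R) (fun x => \sum_(z in A) meet x z) (fun=> 5) _ _ x) => //.
      move=> u _; rewrite -[leqLHS]cardA -sum1_card; apply: leq_sum => z _.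
      exact: meet_gt0.
    by rewrite e2 sum_nat_const cardR.
  apply: (@leq_sum_eq _ (fun z => z \in A) (meet x) (fun=> 1) _ _ y) => //.
    by move=> z _; apply: meet_gt0.
  by rewrite e sum_nat_const cardA.
have e : \sum_(z in R) meet x z = 17.
  apply: (@leq_sum_eq _ (fun z => z \in R) (fun x => \sum_(z in R) meet x z) (fun=> 17) _ _ x) => //.
    by move=> u hu; have := sum_meet_self inter hu; rewrite cardR.
  by rewrite e1 sum_nat_const cardR.
apply: (@leq_sum_eq _ (fun z => z \in R :\ x) (meet x) (fun=> 1) _ _ y).
- by move=> z _; apply: meet_gt0.
- move: e; rewrite (big_setD1 x) //= meetxx sum_nat_const muln1.
  have := cardsD1 x R; rewrite hx cardR.
  by move: #|_| (\sum_(z in _) _); clear; lia.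
- by rewrite in_setD1 eq_sym xy inE.
Qed.

(** A side with fewer than two classes meeting [R] in three rows has [sq t = 25]. Since
    [187 = 25 + 6 * 27], all other sides then attain 27, which off the side of [v] leaves only
    [good_profiles]. *)
Lemma vertex_cases :
  (forall t, count (fun c => #|c :&: R| == 3) (classes t) = 2) \/
  exists2 t1, t1 != v.1 & forall t, t != v.1 -> exists2 cs, perm_eq cs (classes t)
    & map (profile R A) cs \in bad_profile :: (if t == t1 then [::] else good_profiles).
Proof.
have cnt t cs : perm_eq cs (classes t) ->
    count (fun o => o.1 == 3) (rev (map (profile R A) cs)) =
    count (fun c => #|c :&: R| == 3) (classes t).
  by move=> pc; rewrite count_rev count_map -(permP pc).
have fin t : t != v.1 -> count (fun c => #|c :&: R| == 3) (classes t) = 2 \/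
    (sq t = 25 /\ exists2 cs, perm_eq cs (classes t) & map (profile R A) cs = bad_profile).
  move=> tv; have [cs pc /and4P[_ _ h27]] := side_profile t.
  have := w_eq t; rewrite /bound (negPf tv) /w => ew.
  move: h27; rewrite (cnt _ _ pc) (sqE pc) (crE pc) ew sq_ge eqxx /= revK.
  move=> h27 /or3P[/andP[e27 _]|/andP[/eqP e25 /eqP e]|/andP[_ /eqP]].
  - by left; move: h27; rewrite e27 => /eqP.
  - by right; split=> //; exists cs.
  - by left.
case: (boolP [forall t, count (fun c => #|c :&: R| == 3) (classes t) == 2]) => [/forallP h|].
  by left=> t; apply/eqP.
rewrite negb_forall => /existsP[t1 h1]; right.
have t1v : t1 != v.1.
  apply: contraNneq h1 => ->; have [cs pc /and4P[_ _ h27 _]] := side_profile v.1.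
  have := w_eq v.1; rewrite /w cr_v addn0 /bound eqxx => e.
  by move: h27; rewrite (cnt _ _ pc) (sqE pc) e.
case: (fin _ t1v) => [e|[e25 [cs1 pc1 e1]]]; first by rewrite e in h1.
exists t1 => // t tv; case: (eqVneq t t1) => [->|tt1].
  by exists cs1; rewrite // e1 inE eqxx.
have [cs pc /and4P[_ _ _]] := side_profile t.
have := w_eq t; rewrite /bound (negPf tv) /w => ew.
have e27 : sq t = 27.
  case: sums => e _; move: e; rewrite (bigD1 t1) //= (bigD1 t) //= e25 => e.
  have : \sum_(i < 7 | (i != t1) && (i != t)) sq i <= 135.
    apply: leq_trans (leq_sum _ (fun i _ => sq_le i)) _; rewrite sum_nat_const.
    have ht : t \in predC1 t1 by exact: tt1.
    have := cardD1 t (predC1 t1); rewrite ht cardC1 card_ord => -[e5].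
    suff -> : #|[pred i : 'I_7 | (i != t1) && (i != t)]| = 5 by [].
    by apply: etrans (esym e5); apply: eq_card => i; rewrite !inE andbC.
  have := sq_le t.
  by move: e; move: (sq t) (\sum_(i < 7 | _) _); clear; lia.
rewrite (sqE pc) (crE pc) ew e27 /= revK orbF => h.
by exists cs; rewrite // inE h orbT.
Qed.

End Vertex.

End Equality.

(** * Triple systems on eleven points *)

Fixpoint disjb (a b : seq bool) : bool :=
  match a, b with
  | x :: a', y :: b' => if (if x then y else false) then false else disjb a' b'
  | _, _ => true
  end.

Fixpoint meet1b (a b : seq bool) : bool :=
  match a, b with
  | x :: a', y :: b' => if (if x then y else false) then disjb a' b' else meet1b a' b'
  | _, _ => true
  end.

Definition has_point (p : nat) (m : seq bool) : bool := nth false m p.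

(** Here [ts] holds the chosen blocks disjoint from [x]: a block is kept if it shares at most one
    point with [x] and does not complete three disjoint blocks. *)
Definition compatible (x : seq bool) (ts : seq (seq bool)) (y : seq bool) : bool :=
  if meet1b x y then
    if disjb x y then ~~ exists_in (disjb y) ts else true
  else false.

(* Backtracking over the points [p :: ps]: [ts] are the chosen blocks and [here] the
   undecided blocks through [p].  The search is cut when fewer than fourteen blocks remain
   in total or fewer than three through [p]. *)
Fixpoint refute (fuel p : nat) (ps : seq nat) (ts here rest : seq (seq bool)) : bool :=
  if fuel is f.+1 then
    if size ts + size here + size rest < 14 then true else
    match here with
    | x :: h =>
        let c := compatible x [seq t <- ts | disjb x t] in
        if refute f p ps (x :: ts) (filter c h) (filter c rest)
        then refute f p ps ts h rest else false
    | [::] =>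
        if count (has_point p) ts < 3 then true else
        if ps is q :: ps' then
          refute f q ps' ts (filter (has_point q) rest)
            [seq m <- rest | ~~ has_point q m]
        else false
    end
  else false.

Fixpoint masks (n : nat) : seq (seq bool) :=
  if n is n'.+1 then [seq true :: m | m <- masks n'] ++ [seq false :: m | m <- masks n']
  else [:: [::]].

Definition triple_mask (i j k : nat) : seq bool :=
  mkseq (fun x => [|| x == i, x == j | x == k]) 11.

(* The blocks through a point of degree three, up to relabelling. *)
Definition lines0 : seq (seq bool) :=
  [:: triple_mask 0 1 2; triple_mask 0 3 4; triple_mask 0 5 6].

Definition candidates : seq (seq bool) :=
  [seq m <- masks 11 | [&& count id m == 3, ~~ has_point 0 m & all (meet1b^~ m) lines0]].

(** The points 7 to 10, which lie on none of [lines0], are processed first. *)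
Lemma refute_lines0 : refute 200 7 [:: 8; 9; 10; 1; 2; 3; 4; 5; 6] lines0
  (filter (has_point 7) candidates) [seq m <- candidates | ~~ has_point 7 m].
Proof. by vm_compute. Qed.

Lemma mem_masks m : m \in masks (size m).
Proof.
elim: m => //= b m IH; rewrite mem_cat.
by case: b; apply/orP; [left | right]; apply: map_f.
Qed.

Section Refute.

Variable S : seq (seq bool).
Hypothesis uS : uniq S.
Hypothesis sizeS : size S = 14.
Hypothesis linS : {in S &, forall a b, a != b -> meet1b a b}.
Hypothesis noS : {in S & &, forall a b c, disjb a b -> disjb a c -> disjb b c -> False}.

(** The invariant places [S] between [ts] and [ts ++ here ++ rest]. Whether or not the next block
    belongs to [S], one of the two branches preserves it. *)
Lemma refuteP f p ps ts here rest : refute f p ps ts here rest ->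
  all (fun q => 3 <= count (has_point q) S) (p :: ps) ->
  {subset ts <= S} -> {subset S <= ts ++ here ++ rest} ->
  all (fun m => ~~ has_point p m) rest -> False.
Proof.
elim: f p ps ts here rest => //= f IH p ps ts here rest.
case: ifP => [lt14 _ _ _ sub _|_].
  have := uniq_leq_size uS sub; rewrite !size_cat sizeS addnA.
  by rewrite leqNgt lt14.
case: here => [|x h].
  case: ifP => [lt3 _ /andP[h3 _] _ sub nr|_].
    have : count (has_point p) S <= count (has_point p) ts.
      rewrite -!size_filter; apply: uniq_leq_size; first exact: filter_uniq.
      move=> m; rewrite !mem_filter => /andP[pm /sub]; rewrite mem_cat pm.
      by case/orP => [->|/(allP nr)]; rewrite ?pm.
    by move=> le; have := leq_trans h3 le; rewrite leqNgt lt3.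
  case: ps => // q ps hr /andP[_ hq] sts sub nr.
  apply: (IH _ _ _ _ _ hr hq sts); last by apply/allP=> m; rewrite mem_filter => /andP[].
  move=> m /sub; rewrite /= !mem_cat !mem_filter => /orP[->//|hm].
  by rewrite hm; case: has_point; rewrite ?orbT.
case: ifP => // h1 h2 hq sts sub nr.
case: (boolP (x \in S)) => xS; last first.
  apply: (IH _ _ _ _ _ h2 hq sts _ nr) => m mS; have := sub m mS.
  rewrite !mem_cat inE; case: eqP => [e|_] //=.
  by move: xS; rewrite -e mS.
apply: (IH _ _ _ _ _ h1 hq).
- by move=> m; rewrite inE => /orP[/eqP->//|/sts].
- move=> m mS; have := sub m mS.
  rewrite mem_cat => /orP[mt|]; first by rewrite !mem_cat inE mt orbT.
  rewrite cat_cons inE; case: eqP => [->|/eqP ne /=]; first by rewrite mem_cat inE eqxx.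
  have cm : compatible x [seq t <- ts | disjb x t] m.
    rewrite /compatible linS //; last by rewrite eq_sym.
    case: ifP => // dxm; apply/negP; rewrite exists_inE => /hasP[t].
    rewrite mem_filter => /andP[dxt /sts tS] dmt.
    exact: (noS xS mS tS).
  by rewrite inE !mem_cat !mem_filter cm => /orP[]->; rewrite ?orbT.
- by apply/allP=> m; rewrite mem_filter => /andP[_ /(allP nr)].
Qed.

Lemma no_triple_system : {in S, forall m, size m = 11 /\ count id m = 3} ->
  {subset lines0 <= S} -> count (has_point 0) S <= 3 ->
  (forall q, q < 11 -> 3 <= count (has_point q) S) -> False.
Proof.
move=> sz l0 c0 deg; apply: (refuteP refute_lines0) => //.
- by apply/allP=> q hq; apply: deg; move: hq; rewrite !inE; lia.
- move=> m mS; rewrite mem_cat; case: (boolP (m \in lines0)) => [//|ml]; rewrite orFb.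
  (* With [lines0], a further block through 0 would give this point degree 4. *)
  have nm : ~~ has_point 0 m.
    apply/negP=> pm; have : uniq (m :: lines0) by rewrite /= ml.
    move=> u; have : size (m :: lines0) <= count (has_point 0) S.
      rewrite -size_filter; apply: uniq_leq_size => // z; rewrite mem_filter.
      rewrite inE => /orP[/eqP->|hz]; first by rewrite pm.
      rewrite l0 // andbT; move: hz; rewrite !inE.
      by case/or3P=> /eqP->.
    by move=> le; have := leq_trans le c0.
  have [sm cm] := sz m mS.
  have mc : m \in candidates.
    have := mem_masks m; rewrite sm => mm; rewrite mem_filter mm andbT.
    apply/and3P; split; [exact/eqP | exact: nm |]; apply/allP=> l hl.
    by apply: linS => //; [apply: l0 | apply: contraNneq ml => <-].
  rewrite mem_cat; apply/orP; case: (boolP (has_point 7 m)) => h7; [left | right].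
    by rewrite mem_filter h7 mc.
  by rewrite mem_filter h7 mc.
Qed.

End Refute.

(** * The triples cut out by the classes outside a star *)

Lemma disjb_mask (T : finType) (A B : {set T}) s :
  disjb [seq x \in A | x <- s] [seq x \in B | x <- s] = ~~ has (mem (A :&: B)) s.
Proof. by elim: s => //= x s ->; rewrite inE; case: (x \in A); case: (x \in B). Qed.

Lemma meet1b_mask (T : finType) (A B : {set T}) s :
  meet1b [seq x \in A | x <- s] [seq x \in B | x <- s] = (count (mem (A :&: B)) s <= 1).
Proof.
elim: s => //= x s ->; rewrite disjb_mask inE.
case: (x \in A); case: (x \in B) => //=.
by rewrite has_count -leqNgt add1n ltnS.
Qed.

Section Triples.

Variables (I : finType) (V : eqType) (M : I -> 'I_7 -> V).
Hypothesis inter : forall x y, exists t, M x t == M y t.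
Hypothesis card_I : #|I| = 16.
Hypothesis nocov : forall vs, size vs <= 5 -> exists x, x \notin covered M vs.

Local Notation star := (star M).
Local Notation covered := (covered M).
Local Notation meet := (meet M).
Local Notation classes := (classes M).

Variable v : 'I_7 * I.
Local Notation A := (star v.1 v.2).
Local Notation R := (~: star v.1 v.2).
Hypothesis cardA : #|A| = 5.
Hypothesis two3 : forall t, count (fun c => #|c :&: R| == 3) (classes t) = 2.

Let cardR : #|R| = 11.
Proof. by have := cardsC A; rewrite card_I cardA; clear; lia. Qed.

Let heavy t : seq {set I} := [seq c <- classes t | #|c :&: R| == 3].

Let mem_heavy t c : (c \in heavy t) = (#|c :&: R| == 3) && (c \in classes t).
Proof. exact: mem_filter. Qed.

Let blocks : seq {set I} := [seq c :&: R | t <- enum 'I_7, c <- heavy t].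

Let blocksP D : reflect (exists t x, D = star t x :&: R /\ #|D| = 3) (D \in blocks).
Proof.
apply: (iffP allpairsPdep) => [[t [c [_]]]|[t [x [-> h]]]].
  rewrite mem_heavy => /andP[/eqP h /mem_classes[x e]] ->.
  by exists t, x; rewrite -e.
exists t, (star t x); split=> //; first by rewrite mem_enum.
by rewrite mem_heavy h star_classes.
Qed.

(** Two distinct rows, one of them outside [A], meet on one side only. *)
Let same_side t t' x y u w : u \in star t x :&: star t' y -> w \in star t x :&: star t' y ->
  u \in R -> u != w -> t = t'.
Proof.
rewrite !in_setI !mem_star => /andP[/eqP a1 /eqP a2] /andP[/eqP a3 /eqP a4] uR uw.
have /eqP := rest_meet1 inter card_I nocov cardA uR uw.
rewrite /meet => /cards1P[s es].
have h1 : t \in [set s] by rewrite -es inE a1 a3.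
have h2 : t' \in [set s] by rewrite -es inE a2 a4.
by move: h1 h2; rewrite !inE => /eqP-> /eqP->.
Qed.

Let linear D D' : D \in blocks -> D' \in blocks -> D != D' -> #|D :&: D'| <= 1.
Proof.
move=> /blocksP[t [x [eD cD]]] /blocksP[t' [y [eD' cD']]] ne; rewrite leqNgt.
apply/negP=> /card_gt1P[u [w [hu hw uw]]].
move: hu hw; rewrite eD eD' !in_setI => /andP[/andP[u1 uR] /andP[u2 _]].
move=> /andP[/andP[w1 wR] /andP[w2 _]].
have e : t = t'.
  by apply: (@same_side t t' x y u w) => //; rewrite in_setI ?u1 ?u2 ?w1 ?w2.
case/negP: ne; rewrite eD eD'; apply/eqP; congr (_ :&: _).
move: u1 u2; rewrite -e !mem_star => /eqP e1 /eqP e2.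
by apply/eqP; rewrite eq_star -e1 e2.
Qed.

Let uniq_blocks : uniq blocks.
Proof.
apply: allpairs_uniq_dep; first exact: enum_uniq.
  by move=> t _; apply: filter_uniq; apply: classes_uniq.
pose val2 (p : {_ : 'I_7 & {set I}}) := tagged p.
have inv p : p \in [seq existT (fun=> {set I} : Type) t c | t <- enum 'I_7, c <- heavy t] ->
    val2 p \in heavy (tag p).
  case/allpairsPdep=> t [c [_ hc ->]]; exact: hc.
move=> [t c] [t' c'] /inv /= + /inv /= + e; rewrite /val2 /= !mem_heavy.
move=> /andP[c3 hc] /andP[c3' hc'].
have c3c : #|c :&: R| = 3 by apply/eqP.
have /card_gt1P[u [w [hu hw uw]]] : 1 < #|c :&: R| by rewrite c3c.
move: (hu) (hw); rewrite {1 2}e !in_setI => /andP[u2 uR] /andP[w2 _].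
move: hu hw; rewrite !in_setI => /andP[u1 _] /andP[w1 _].
have [x ex] := mem_classes M t c hc; have [y ey] := mem_classes M t' c' hc'.
have et : t = t'.
  by apply: (@same_side t t' x y u w) => //; rewrite in_setI -ex -ey ?u1 ?u2 ?w1 ?w2.
subst t'; have -> : c = c' by rewrite (classes_star hc u1) (classes_star hc' u2).
by [].
Qed.

Let size_blocks : size blocks = 14.
Proof.
rewrite size_allpairs_dep sumnE big_map (eq_bigr (fun=> 2)) => [|t _].
  by rewrite big_enum sum_nat_const card_ord.
by rewrite size_filter two3.
Qed.

(** [v] and the vertices of the three blocks would cover [5 + 9 = 14] rows, against [5 + 2 * 4]. *)
Let no_three D1 D2 D3 : D1 \in blocks -> D2 \in blocks -> D3 \in blocks ->
  D1 :&: D2 = set0 -> D1 :&: D3 = set0 -> D2 :&: D3 = set0 -> False.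
Proof.
move=> /blocksP[t1 [x1 [e1 c1]]] /blocksP[t2 [x2 [e2 c2]]] /blocksP[t3 [x3 [e3 c3]]].
move=> d12 d13 d23.
have := @cov_bound _ _ _ inter card_I nocov [:: v; (t1, x1); (t2, x2); (t3, x3)] isT.
have sub : A :|: (D1 :|: (D2 :|: D3)) \subset covered [:: v; (t1, x1); (t2, x2); (t3, x3)].
  rewrite !covered_cons /=; apply: setUS; apply: setUSS; first by rewrite e1 subsetIl.
  apply: setUSS; first by rewrite e2 subsetIl.
  by apply: subset_trans (subsetUl _ _); rewrite e3 subsetIl.
move/(leq_trans (subset_leq_card sub)).
have AR : A :&: R = set0 by rewrite setICr.
rewrite !cardsU d23 setIUr d12 d13 setU0 !setIUr e1 e2 e3 !(setICA A) AR !setI0 !setU0.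
by rewrite -e1 -e2 -e3 cards0 cardA c1 c2 c3.
Qed.

Let deg e : nat := count (fun D : {set I} => e \in D) blocks.

(** By [rest_meet1] the classes of [e] have parts in [R] of total size [7 + 10 = 7 * 2 + 3], and no
    part exceeds 3. *)
Let deg_ge3 e : e \in R -> 3 <= deg e.
Proof.
move=> eR; pose T3 := [set t | #|star t e :&: R| == 3].
have t3 : 3 <= #|T3|.
  have h17 : \sum_(t < 7) #|star t e :&: R| = 17.
    rewrite sum_star1 (big_setD1 e) //= meetxx (eq_bigr (fun=> 1)).
      by rewrite sum_nat_const; have := cardsD1 e R; rewrite eR cardR; clear; lia.
    move=> y; rewrite in_setD1 => /andP[ye _].
    by apply: (rest_meet1 inter card_I nocov cardA eR); rewrite eq_sym.
  have : \sum_(t < 7) #|star t e :&: R| <= \sum_(t < 7) (2 + (t \in T3)).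
    apply: leq_sum => t _; rewrite inE.
    by have := rest_le3 inter card_I nocov cardA t e; case: #|_| => [|[|[|[|]]]].
  rewrite h17 big_split /= sum_nat_const card_ord -sum1_card [X in _ -> _ < X]big_mkcond /=.
  by rewrite (eq_bigr (fun t => if t \in T3 then 1 else 0)) ?leq_add2l // => t _; case: ifP.
rewrite /deg -size_filter; apply: leq_trans t3 _; rewrite cardE.
rewrite -(size_map (fun t => star t e :&: R)); apply: uniq_leq_size.
  rewrite map_inj_in_uniq ?enum_uniq // => t t'; rewrite !mem_enum !inE => h h' ee.
  have /card_gt1P[u [w [hu hw uw]]] : 1 < #|star t e :&: R| by rewrite (eqP h).
  move: (hu) (hw); rewrite {1 2}ee !in_setI => /andP[u2 uR] /andP[w2 _].
  move: hu hw; rewrite !in_setI => /andP[u1 _] /andP[w1 _].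
  by apply: (@same_side t t' e e u w) => //; rewrite in_setI ?u1 ?u2 ?w1 ?w2.
move=> D /mapP[t]; rewrite mem_enum inE => /eqP h ->; rewrite mem_filter in_setI star_refl eR.
by apply/blocksP; exists t, e.
Qed.

(** The 14 triples have 42 incidences, fewer than [11 * 4]. *)
Let exists_deg3 : exists2 e, e \in R & deg e = 3.
Proof.
have sumdeg : \sum_(e in R) deg e = 42.
  rewrite /deg; under eq_bigr do rewrite -sum1_count big_mkcond.
  rewrite exchange_big /= (eq_big_seq (fun=> 3)) => [|D /blocksP[t [x [eD cD]]]].
    by rewrite big_const_seq count_predT size_blocks.
  rewrite -big_mkcondr -[RHS]cD -sum1_card; apply: eq_bigl => e.
  by rewrite eD in_setI [RHS]andbC andbCA andbb andbC.
have /existsP[e /andP[eR h]] : [exists e, (e \in R) && (deg e <= 3)].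
  rewrite -[X in is_true X]negbK negb_exists; apply/negP=> /forallP h.
  suff : 44 <= \sum_(e in R) deg e by rewrite sumdeg.
  rewrite -[44]/(11 * 4) -cardR -sum_nat_const; apply: leq_sum => e eR.
  by have := h e; rewrite eR /= -ltnNge.
by exists e => //; apply/eqP; rewrite eqn_leq h deg_ge3.
Qed.

Lemma not_all_two3 : False.
Proof.
have [e eR de] := exists_deg3.
have : size [seq D : {set I} <- blocks | e \in D] = 3 by rewrite size_filter.
have mem3 (D : {set I}) : D \in [seq D : {set I} <- blocks | e \in D] -> (e \in D) && (D \in blocks).
  by rewrite mem_filter.
have u3 : uniq [seq D : {set I} <- blocks | e \in D] by apply: filter_uniq.
case: [seq D : {set I} <- blocks | e \in D] mem3 u3 => [|D1 [|D2 [|D3 [|]]]] // mem3 u3 _.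
have /andP[m1 b1] : (e \in D1) && (D1 \in blocks) by apply: mem3; rewrite !inE eqxx.
have /andP[m2 b2] : (e \in D2) && (D2 \in blocks) by apply: mem3; rewrite !inE eqxx ?orbT.
have /andP[m3 b3] : (e \in D3) && (D3 \in blocks) by apply: mem3; rewrite !inE eqxx ?orbT.
have split3 (D : {set I}) : D \in blocks -> e \in D -> exists x y, [/\ x != e, y != e, x != y & D = [set e; x; y]].
  move=> /blocksP[t [z [_ c3]]] eD.
  have : #|D :\ e| = 2 by have := cardsD1 e D; rewrite eD c3; clear; lia.
  move/eqP/cards2P=> [x [y [xy eDe]]]; exists x, y.
  have hx : x \in D :\ e by rewrite eDe !inE eqxx.
  have hy : y \in D :\ e by rewrite eDe !inE eqxx orbT.
  move: hx hy; rewrite !in_setD1 => /andP[xe _] /andP[ye _]; split=> //.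
  by rewrite -(setD1K eD) eDe setUA.
have [x1 [y1 [x1e y1e xy1 E1]]] := split3 _ b1 m1.
have [x2 [y2 [x2e y2e xy2 E2]]] := split3 _ b2 m2.
have [x3 [y3 [x3e y3e xy3 E3]]] := split3 _ b3 m3.
have dis (D D' : {set I}) z : D \in blocks -> D' \in blocks -> D != D' -> e \in D -> e \in D' ->
    z != e -> z \in D -> z \notin D'.
  move=> h h' ne eD eD' ze zD; apply/negP=> zD'; have := linear h h' ne.
  rewrite leqNgt => /negP; apply; apply/card_gt1P; exists e, z.
  by rewrite !in_setI eD eD' zD zD' eq_sym.
move: u3; rewrite /= !inE negb_or !andbT => /andP[/andP[n12 n13] n23].
pose seven := [:: e; x1; y1; x2; y2; x3; y3].
have sub7 : {subset seven <= R}.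
  have inR (D : {set I}) : D \in blocks -> D \subset R.
    by case/blocksP=> t [x [-> _]]; apply: subsetIr.
  have s1 := subsetP (inR _ b1); have s2 := subsetP (inR _ b2); have s3 := subsetP (inR _ b3).
  move=> z; rewrite !inE; move: s1 s2 s3; rewrite E1 E2 E3 => s1 s2 s3.
  have k1 w : w \in R -> ~~ (M w v.1 == M v.2 v.1) by rewrite !inE.
  case/or4P=> [/eqP->|/eqP->|/eqP->|].
  - by apply: k1.
  - by apply/k1/s1; rewrite !inE eqxx ?orbT.
  - by apply/k1/s1; rewrite !inE eqxx ?orbT.
  case/or4P=> [/eqP->|/eqP->|/eqP->|/eqP->].
  - by apply/k1/s2; rewrite !inE eqxx ?orbT.
  - by apply/k1/s2; rewrite !inE eqxx ?orbT.
  - by apply/k1/s3; rewrite !inE eqxx ?orbT.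
  - by apply/k1/s3; rewrite !inE eqxx ?orbT.
have [X1 Y1] : x1 \in D1 /\ y1 \in D1 by rewrite E1 !inE !eqxx ?orbT.
have [X2 Y2] : x2 \in D2 /\ y2 \in D2 by rewrite E2 !inE !eqxx ?orbT.
have [X3 Y3] : x3 \in D3 /\ y3 \in D3 by rewrite E3 !inE !eqxx ?orbT.
have f12x := dis _ _ _ b1 b2 n12 m1 m2 x1e X1; have f12y := dis _ _ _ b1 b2 n12 m1 m2 y1e Y1.
have f13x := dis _ _ _ b1 b3 n13 m1 m3 x1e X1; have f13y := dis _ _ _ b1 b3 n13 m1 m3 y1e Y1.
have f23x := dis _ _ _ b2 b3 n23 m2 m3 x2e X2; have f23y := dis _ _ _ b2 b3 n23 m2 m3 y2e Y2.
have uniq7 : uniq seven.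
  move: f12x f12y f13x f13y f23x f23y; rewrite E2 E3 !inE !negb_or.
  move=> /andP[/andP[_ p1] p2] /andP[/andP[_ p3] p4] /andP[/andP[_ p5] p6].
  move=> /andP[/andP[_ p7] p8] /andP[/andP[_ p9] p10] /andP[/andP[_ p11] p12].
  rewrite /seven /= !inE !negb_or !(eq_sym e) x1e y1e x2e y2e x3e y3e xy1 xy2 xy3.
  by rewrite p1 p2 p3 p4 p5 p6 p7 p8 p9 p10 p11 p12.
(* This numbering of [R] turns the three blocks through [e] into [lines0]. *)
pose rs := seven ++ enum (R :\: [set z in seven]).
have urs : uniq rs.
  rewrite cat_uniq uniq7 enum_uniq andbT; apply/hasPn=> x.
  by rewrite mem_enum in_setD in_set => /andP[].
have mrs x : (x \in rs) = (x \in R).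
  rewrite mem_cat mem_enum in_setD in_set; case: (boolP (x \in seven)) => //= h.
  by rewrite (sub7 _ h).
have srs : size rs = 11 by rewrite -(card_uniqP urs) -cardR; apply: eq_card.
pose mask (D : {set I}) : seq bool := [seq x \in D | x <- rs].
have maskC (D : {set I}) : D \subset R -> count (mem D) rs = #|D|.
  move=> sD; rewrite -size_filter -(card_uniqP (filter_uniq _ urs)).
  apply: eq_card => x; rewrite mem_filter mrs /=.
  by case: (boolP (x \in D)) => //= /(subsetP sD).
have inR (D : {set I}) : D \in blocks -> D \subset R.
  by case/blocksP=> t [x [-> _]]; apply: subsetIr.
have maskI : {in blocks &, injective mask}.
  move=> D D' hD hD' em; apply/setP=> x; case: (boolP (x \in R)) => xR; last first.
    have nx (E : {set I}) : E \in blocks -> (x \in E) = false.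
      by move=> hE; apply: contraNF xR => /(subsetP (inR _ hE)).
    by rewrite !nx.
  have hx : index x rs < size rs by rewrite index_mem mrs.
  have := congr1 (fun m => nth false m (index x rs)) em.
  by rewrite !(nth_map x) ?nth_index // mrs.
have hp q (D : {set I}) : q < 11 -> has_point q (mask D) = (nth e rs q \in D).
  by move=> hq; rewrite /has_point (nth_map e) ?srs.
have cnt q : q < 11 -> count (has_point q) (map mask blocks) = deg (nth e rs q).
  move=> hq; rewrite count_map; apply: eq_count => D /=; exact: hp.
apply: (@no_triple_system (map mask blocks)).
- by rewrite map_inj_in_uniq.
- by rewrite size_map size_blocks.
- move=> _ _ /mapP[D hD ->] /mapP[D' hD' ->] ne; rewrite meet1b_mask maskC.
    by apply: linear => //; apply: contraNneq ne => ->.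
  by apply: subset_trans (subsetIl _ _) (inR _ hD).
- move=> _ _ _ /mapP[D hD ->] /mapP[D' hD' ->] /mapP[D'' hD'' ->].
  have dj (E E' : {set I}) : E \in blocks -> disjb (mask E) (mask E') -> E :&: E' = set0.
    move=> hE; rewrite disjb_mask => /hasPn h; apply/setP=> x; rewrite in_set0.
    apply/negP=> hx; have xr : x \in rs.
      by rewrite mrs (subsetP (inR _ hE)) //; move: hx; rewrite in_setI => /andP[].
    by have := h x xr; rewrite /= hx.
  by move=> /dj-/(_ hD) h1 /dj-/(_ hD) h2 /dj-/(_ hD') h3; apply: (no_three hD hD' hD'').
- move=> _ /mapP[D hD ->]; rewrite size_map srs count_map; split=> //.
  have [t [x [_ c3]]] := blocksP _ hD.
  by rewrite -[RHS]c3 -(maskC _ (inR _ hD)); apply: eq_count.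
- have sm (D : {set I}) i j k : D \in blocks -> D = [set nth e rs i; nth e rs j; nth e rs k] ->
      i < 11 -> j < 11 -> k < 11 -> triple_mask i j k = mask D.
    move=> hD ED hi hj hk; apply: (@eq_from_nth _ false); rewrite ?size_mkseq ?size_map // => q hq.
    rewrite nth_mkseq // (nth_map e) ?srs // ED !inE !nth_uniq ?srs // orbA //.
  have t1 : triple_mask 0 1 2 = mask D1 by apply: sm.
  have t2 : triple_mask 0 3 4 = mask D2 by apply: sm.
  have t3 : triple_mask 0 5 6 = mask D3 by apply: sm.
  move=> m; rewrite /lines0 t1 t2 t3 !inE => /or3P[]/eqP->; exact: map_f.
- by rewrite cnt // de.
- move=> q hq; rewrite cnt //; apply: deg_ge3.
  by rewrite -mrs mem_nth // srs.
Qed.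

End Triples.

(** * The two bounds *)

Definition check_profile (l : seq (nat * nat)) : bool :=
  [&& has (fun o => psize o == 1) l,
      all (fun o => (psize o == 1) ==> (o == (0, 1))) l
    & has (pred1 (3, 2)) l || all (fun o => psize o <= 4) l].

Lemma check_profiles l : l \in bad_profile :: good_profiles -> check_profile l.
Proof. by move: l; apply/allP. Qed.

(** * Contradiction from two vertices of degree five *)

Section Final.

Variables (I : finType) (V : eqType) (M : I -> 'I_7 -> V).
Hypothesis inter : forall x y, exists t, M x t == M y t.
Hypothesis card_I : #|I| = 16.
Hypothesis nocov : forall vs, size vs <= 5 -> exists x, x \notin covered M vs.

Local Notation star := (star M).
Local Notation meet := (meet M).
Local Notation classes := (classes M).

(** The exceptional side in [vertex_cases] has a class of profile [(3, 2)], which supplies the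
    second vertex of degree 5. The rest is read off the possible profiles. *)
Lemma vertex_structure v : #|star v.1 v.2| = 5 ->
  (exists t1 x, [/\ t1 != v.1, #|star t1 x| = 5 & #|star t1 x :&: star v.1 v.2| = 2]) /\
  (forall t, t != v.1 ->
    [/\ exists z, #|star t z| = 1,
        forall z, #|star t z| = 1 -> z \in star v.1 v.2
      & (exists2 y, #|star t y| = 5 & #|star t y :&: star v.1 v.2| = 2) \/
        forall y, #|star t y| <= 4]).
Proof.
move=> cardA; case: (vertex_cases inter card_I nocov cardA) => [h|].
  by case: (not_all_two3 inter card_I nocov cardA h).
set A := star v.1 v.2; set R := ~: A => -[t1 t1v h].
have RA : R :|: A = setT by rewrite setUC setUCr.
have RA0 : R :&: A = set0 by rewrite setIC setICr.
have p32 t cs : perm_eq cs (classes t) -> has (pred1 (3, 2)) (map (profile R A) cs) ->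
    exists2 y, #|star t y| = 5 & #|star t y :&: A| = 2.
  move=> pc /hasP[o /mapP[c hc ->] /eqP e].
  have [y ey] := mem_classes M t c ltac:(by rewrite -(perm_mem pc)).
  exists y; rewrite -ey; last by move: e => [].
  by rewrite -(psize_profile c RA RA0) e.
split.
  have [cs pc] := h t1 t1v; rewrite eqxx inE => /eqP e.
  have [|y y5 y2] := p32 _ _ pc; first by rewrite e.
  by exists t1, y.
move=> t tv; have [cs pc hl] := h t tv.
have /and3P[/hasP[o /mapP[c hc ->] c1] /allP all1 h5] : check_profile (map (profile R A) cs).
  apply: check_profiles; move: hl; case: (t == t1) => //.
  by rewrite mem_seq1 => /eqP->; apply: mem_head.
have mc d : (d \in cs) = (d \in classes t) by apply: perm_mem.
split.
- have [z ez] := mem_classes M t c ltac:(by rewrite -mc).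
  by exists z; rewrite -ez -(psize_profile c RA RA0); apply/eqP.
- move=> z hz; have hs : star t z \in cs by rewrite mc star_classes.
  have := all1 _ (map_f (profile R A) hs); rewrite psize_profile // hz /= => /eqP[e _].
  have := star_refl M t z; apply: contraLR => zA.
  have zR : z \in R by rewrite in_setC.
  apply/negP=> zs; have : z \in star t z :&: R by rewrite in_setI zs zR.
  by move/eqP: e; rewrite cards_eq0 => /eqP->; rewrite inE.
case/orP: h5 => [/(p32 _ _ pc)|/allP h4]; [by left | right=> y].
have hs : star t y \in cs by rewrite mc star_classes.
by have := h4 _ (map_f (profile R A) hs); rewrite psize_profile.
Qed.

(** The two rows [a] and [a'] common to both stars have degrees adding up to at least [23 + 23]. The
    sides of the two vertices contribute 10 each and the five others at most 5 each, 45 in all. *)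
Lemma no_cover_free_family : False.
Proof.
have [v /eqP cardA] := exists_degree5 inter card_I nocov.
have [[t1 [x [t1v cardU card2]]] sv] := vertex_structure cardA.
have [_ su] := @vertex_structure (t1, x) cardU; rewrite /= in su.
set A := star v.1 v.2 in cardA card2 sv *; set U := star t1 x in cardU card2 su *.
have [a [a' [aa' eUA]]] : exists a a', a != a' /\ U :&: A = [set a; a'].
  by move/eqP/cards2P: card2 => [a [a' [? ?]]]; exists a, a'.
have inUA z : (z \in U) && (z \in A) = (z == a) || (z == a').
  by have := in_setI z U A; rewrite eUA !inE => <-.
have [aU aA] : a \in U /\ a \in A by apply/andP; rewrite inUA eqxx.
have [a'U a'A] : a' \in U /\ a' \in A by apply/andP; rewrite inUA eqxx orbT.
have meet2 p q : p != q -> p \in A -> q \in A -> forall t y, t != v.1 -> p \in star t y ->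
    q \in star t y -> 2 <= meet p q.
  move=> pq; rewrite !mem_star => /eqP pA /eqP qA t y tv.
  rewrite !mem_star => /eqP ps /eqP qs.
  by apply/card_gt1P; exists v.1, t; split;
    [rewrite inE pA qA | rewrite inE ps qs | rewrite eq_sym].
(* The class of one row on side [t] lies in both stars, so it consists of [a] or [a']. A class of
   five rows there would contain two rows of [A]; these meet twice, hence lie in [U] and are [a] and
   [a'], contrary to one of them being alone. *)
have other t : t != v.1 -> t != t1 -> #|star t a| + #|star t a'| <= 5.
  move=> tv tt1; have [[z z1] hv h5] := sv t tv; have [_ hu _] := su t tt1.
  have := inUA z; rewrite (hu z z1) (hv z z1) => /esym za.
  case: h5 => [[y y5 y2]|le4]; last first.
    have := le4 a; have := le4 a'; case/orP: za => /eqP e; rewrite -e z1; lia.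
  have /card_gt1P[p [q [hp hq pq]]] : 1 < #|star t y :&: A| by rewrite y2.
  move: hp hq; rewrite !in_setI => /andP[py pA] /andP[qy qA].
  have m2 := meet2 _ _ pq pA qA _ _ tv py qy.
  have inU w w' : w != w' -> 2 <= meet w w' -> w \in U.
    move=> ww; apply: contraTT => wU.
    by rewrite (@rest_meet1 _ _ _ inter card_I nocov (t1, x) cardU w w') // in_setC.
  have pU := inU _ _ pq m2.
  have qU : q \in U.
    apply: (inU q p); first by rewrite eq_sym.
    by apply: (meet2 q p _ qA pA t y tv qy py); rewrite eq_sym.
  have := inUA p; rewrite pU pA => /esym pa; have := inUA q; rewrite qU qA => /esym qa.
  have zy : z \in star t y.
    have : (z == p) || (z == q).
      case/orP: za => /eqP->; case/orP: pa => /eqP ep; case/orP: qa => /eqP eq;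
      rewrite ep eq ?eqxx ?orbT //; by move: pq; rewrite ep eq eqxx.
    by case/orP=> /eqP->.
  have : star t z = star t y.
    by apply/eqP; rewrite eq_star -mem_star.
  by move=> e; move: y5; rewrite -e z1.
(* Row [c] meets itself 7 times, [c'] at least twice (on sides [v.1] and [t1]) and each of the 14
   other rows at least once. *)
have low c c' : c != c' -> c \in U -> c' \in U -> c \in A -> c' \in A ->
    23 <= \sum_(t < 7) #|star t c|.
  move=> cc cU c'U cA c'A.
  have -> : \sum_(t < 7) #|star t c| = \sum_(y in setT) meet c y.
    by rewrite -sum_star1; apply: eq_bigr => t _; rewrite setIT.
  rewrite (big_setD1 c) ?in_setT //= meetxx (big_setD1 c') /=; last first.
    by rewrite !inE eq_sym cc.
  have := meet2 _ _ cc cA c'A t1 x t1v cU c'U.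
  have : #|[set: I] :\ c :\ c'| <= \sum_(i in [set: I] :\ c :\ c') meet c i.
    by rewrite -sum1_card; apply: leq_sum => i _; apply: meet_gt0.
  have e1 := cardsD1 c [set: I]; have e2 := cardsD1 c' ([set: I] :\ c).
  move: e1 e2; rewrite cardsT card_I !inE (eq_sym c') cc /=.
  move: #|_| #|_| (meet c c') (\sum_(i in _) _); clear; lia.
have := low _ _ aa' aU a'U aA a'A.
have := low _ _ _ a'U aU a'A aA; rewrite eq_sym => /(_ aa').
suff : \sum_(t < 7) (#|star t a| + #|star t a'|) <= 45.
  by rewrite big_split /=; move: (\sum_(t < 7) #|star t a|) (\sum_(t < 7) #|star t a'|); clear; lia.
rewrite (bigD1 v.1) //= (bigD1 t1) //=.
have sA c : c \in A -> #|star v.1 c| = 5.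
  move=> cA; suff -> : star v.1 c = A by [].
  by apply/eqP; rewrite /A eq_star -mem_star.
have sU c : c \in U -> #|star t1 c| = 5.
  move=> cU; suff -> : star t1 c = U by [].
  by apply/eqP; rewrite /U eq_star -mem_star.
rewrite (sA _ aA) (sA _ a'A) (sU _ aU) (sU _ a'U).
suff h25 : \sum_(i < 7 | (i != v.1) && (i != t1)) (#|star i a| + #|star i a'|) <= 25.
  exact: leq_add (leqnn (5 + 5)) (leq_add (leqnn (5 + 5)) h25).
apply: (@leq_trans (\sum_(i < 7 | (i != v.1) && (i != t1)) 5)).
  by apply: leq_sum => t /andP[h1 h2]; apply: other.
rewrite sum_nat_const.
have ht : t1 \in predC1 v.1 by exact: t1v.
have := cardD1 t1 (predC1 v.1); rewrite ht cardC1 card_ord => -[e5].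
suff -> : #|[pred i : 'I_7 | (i != v.1) && (i != t1)]| = 5 by [].
by apply: etrans (esym e5); apply: eq_card => i; rewrite !inE andbC.
Qed.

End Final.

(** * From hypergraphs to sixteen rows *)

Lemma partite_cover r (T : finType) (H : {set {set T}}) :
  0 < r -> partite r H -> vertex_cover H [set: T].
Proof.
case: r => // r _ [side h]; apply/forallP=> e; apply/implyP=> eH; rewrite setIT.
by have := h e ord0 eH; apply: contra_eqN => /eqP->; rewrite set0I cards0.
Qed.

Lemma tau_le (T : finType) (H : {set {set T}}) C :
  vertex_cover H [set: T] -> vertex_cover H C -> tau H <= #|C|.
Proof. by move=> hT hC; rewrite /tau; case: arg_minnP => // D _; apply. Qed.

Lemma tau_ge (T : finType) (H : {set {set T}}) n : vertex_cover H [set: T] ->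
  (forall C, vertex_cover H C -> n <= #|C|) -> n <= tau H.
Proof. by move=> hT h; rewrite /tau; case: arg_minnP => // D hD _; apply: h. Qed.

Lemma witness7_ge17 k : f_witness 7 k -> 17 <= k.
Proof.
case=> T [H [hp hi cH ht]]; rewrite leqNgt; apply/negP=> lt17.
have hT := @partite_cover 7 _ _ isT hp; case: hp => side hs.
have [H0|[e0 e0H]] := set_0Vmem H.
  have : vertex_cover H set0 by apply/forallP=> e; rewrite H0 inE.
  by move/(tau_le hT); rewrite cards0 => h0; have := leq_trans ht h0.
(* Indices beyond the number of edges repeat [e0], which pads the family to sixteen rows. *)
pose row (r : 'I_16) := nth e0 (enum H) r.
have rowH r : row r \in H.
  rewrite /row; case: (ltnP r (size (enum H))) => h; last by rewrite nth_default.
  by rewrite -mem_enum mem_nth.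
pose M (r : 'I_16) (i : 'I_7) : option T := [pick x | (x \in row r) && (side x == i)].
have MP r x : (x \in row r) = (M r (side x) == Some x).
  rewrite /M; case: pickP => [y /andP[yr /eqP ys]|/(_ x)]; last by rewrite eqxx andbT => ->.
  apply/idP/eqP => [xr|[<-]//]; congr Some.
  have /eqP/cards1P[z ez] := hs (row r) (side x) (rowH r).
  have hx : x \in [set z] by rewrite -ez !inE xr eqxx.
  have hy : y \in [set z] by rewrite -ez !inE yr ys eqxx.
  by move: hx hy; rewrite !inE => /eqP-> /eqP->.
apply: (@no_cover_free_family 'I_16 (option T : eqType) M).
- move=> r s; have /set0Pn[x] := hi _ _ (rowH r) (rowH s).
  rewrite inE => /andP[]; rewrite !MP => /eqP e1 /eqP e2.
  by exists (side x); rewrite e1 e2.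
- by rewrite card_ord.
move=> vs sz; apply/existsP; rewrite -[X in is_true X]negbK negb_exists.
apply/negP=> /forallP cov.
(* The vertices named by [vs] would form a cover of at most five vertices, against [tau H >= 6]. *)
pose C := [set x in pmap id [seq M u.2 u.1 | u <- vs]].
have cC : #|C| <= 5.
  rewrite cardsE; apply: leq_trans (card_size _) _; rewrite size_pmap.
  by apply: leq_trans (count_size _ _) _; rewrite size_map.
suff /(tau_le hT) h0 : vertex_cover H C by have := leq_trans (leq_trans ht h0) cC.
apply/forallP=> e; apply/implyP=> eH.
have ie : index e (enum H) < 16.
  have : index e (enum H) < size (enum H) by rewrite index_mem mem_enum.
  by rewrite -cardE cH => h0; apply: leq_trans h0 _; rewrite -ltnS.
have er : row (Ordinal ie) = e by rewrite /row /= nth_index // mem_enum.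
have := cov (Ordinal ie); rewrite negbK /covered bigcup_seq => /bigcupP[u uvs].
rewrite mem_star; have [x] : exists x, M (Ordinal ie) u.1 = Some x.
  rewrite /M; case: pickP => [x _|h0]; first by exists x.
  have /eqP/cards1P[z ez] := hs (row (Ordinal ie)) u.1 (rowH _).
  have : z \in [set z] by rewrite inE.
  by rewrite -ez !inE; have := h0 z => /= ->.
move=> ex /eqP eu; apply/set0Pn; exists x; rewrite inE; apply/andP; split.
  by move: ex; rewrite /M er; case: pickP => // y /andP[ye _] [<-].
rewrite inE mem_pmap map_id; apply/mapP; exists u => //.
by rewrite -ex eu.
Qed.

(** * An explicit family of 17 edges *)

Definition rows17 : seq (seq nat) :=
  [:: [:: 0; 0; 0; 0; 0; 0; 0];
      [:: 1; 1; 1; 1; 1; 1; 0];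
      [:: 1; 0; 2; 2; 2; 2; 1];
      [:: 2; 2; 3; 3; 0; 1; 1];
      [:: 2; 3; 0; 1; 3; 2; 2];
      [:: 3; 2; 1; 0; 2; 3; 2];
      [:: 3; 3; 3; 2; 1; 0; 3];
      [:: 4; 4; 3; 0; 1; 2; 4];
      [:: 0; 3; 4; 4; 2; 1; 4];
      [:: 1; 2; 5; 5; 3; 0; 4];
      [:: 2; 5; 1; 2; 0; 4; 4];
      [:: 3; 0; 3; 1; 4; 5; 4];
      [:: 1; 3; 3; 0; 5; 4; 5];
      [:: 4; 2; 0; 2; 4; 1; 5];
      [:: 3; 1; 5; 4; 0; 2; 5];
      [:: 5; 5; 3; 1; 2; 0; 5];
      [:: 2; 0; 4; 5; 1; 3; 5]].

(** Each side has six vertices, [(t, j)] being vertex [j] of side [t]; entry [t] of a row names the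
    vertex of the edge on that side. *)
Definition row_edge (r : seq nat) : {set 'I_7 * 'I_6} :=
  [set x : 'I_7 * 'I_6 | nth 0 r x.1 == x.2].

Definition edges17 : {set {set 'I_7 * 'I_6}} := [set e in map row_edge rows17].

(** A cover must contain one of the seven vertices of the first remaining row, so it is enough to
    branch over these. *)
Fixpoint coverable (k : nat) (rows : seq (seq nat)) : bool :=
  if rows is r :: rs then
    if k is k'.+1 then
      exists_in (fun t => coverable k' [seq s <- rs | nth 0 s t != nth 0 r t]) (iota 0 7)
    else false
  else true.

Lemma coverableP k rows (C : {set 'I_7 * 'I_6}) : #|C| <= k ->
  (forall r, r \in rows -> row_edge r :&: C != set0) -> coverable k rows.
Proof.
elim: k rows C => [|k IH] [|r rs] C // hC h.
  have := h r (mem_head _ _); move: hC; rewrite leqn0 cards_eq0 => /eqP->.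
  by rewrite setI0 eqxx.
change (exists_in (fun t => coverable k [seq s <- rs | nth 0 s t != nth 0 r t]) (iota 0 7)).
rewrite exists_inE; have /set0Pn[x] := h r (mem_head _ _).
rewrite in_setI inE => /andP[/eqP xr xC]; apply/hasP; exists (x.1 : nat).
  by rewrite mem_iota ltn_ord.
apply: (IH _ (C :\ x)) => [|s]; first by have := cardsD1 x C; rewrite xC; move: hC; lia.
rewrite mem_filter => /andP[ne srs].
have /set0Pn[y] := h s ltac:(by rewrite inE srs orbT).
rewrite in_setI inE => /andP[/eqP ys yC]; apply/set0Pn; exists y.
rewrite in_setI inE ys eqxx in_setD1 yC andbT /=; apply: contraNneq ne => e.
by rewrite xr -e ys.
Qed.

Lemma rows17_not_coverable : ~~ coverable 5 rows17.
Proof. by vm_compute. Qed.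

Lemma rows17_ok : all (fun r => (size r == 7) && all (fun i => i < 6) r) rows17.
Proof. by []. Qed.

Lemma rows17_inter :
  all (fun r => all (fun s => has (fun t => nth 0 r t == nth 0 s t) (iota 0 7)) rows17) rows17.
Proof. by []. Qed.

Lemma rows17_lt r t : r \in rows17 -> t < 7 -> nth 0 r t < 6.
Proof.
move=> /(allP rows17_ok) /andP[/eqP sr /allP h] lt; apply: h.
by rewrite mem_nth // sr.
Qed.

Definition row_point (r : seq nat) (t : 'I_7) : 'I_7 * 'I_6 := (t, inord (nth 0 r t)).

Lemma row_pointP r t : r \in rows17 -> row_point r t \in row_edge r.
Proof. by move=> hr; rewrite inE /= inordK // rows17_lt. Qed.

Lemma edges17P e : reflect (exists2 r, r \in rows17 & e = row_edge r) (e \in edges17).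
Proof. by rewrite inE; apply: mapP. Qed.

Lemma edges17_partite : partite 7 edges17.
Proof.
exists fst => e i /edges17P[r hr ->]; apply/eqP/cards1P; exists (row_point r i).
apply/setP=> -[t j]; rewrite !inE /= xpair_eqE andbC; case: (eqVneq t i) => //= ->.
by rewrite -val_eqE /= inordK ?rows17_lt // eq_sym.
Qed.

Lemma edges17_intersecting : intersecting edges17.
Proof.
move=> e f /edges17P[r hr ->] /edges17P[s hs ->].
have /hasP[t] := allP (allP rows17_inter r hr) s hs.
rewrite mem_iota /= => lt /eqP e1; apply/set0Pn; exists (row_point r (Ordinal lt)).
by rewrite in_setI row_pointP //= inE /= inordK ?rows17_lt // e1.
Qed.

Lemma card_edges17 : #|edges17| = 17.
Proof.
rewrite cardsE; apply/card_uniqP.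
rewrite map_inj_in_uniq // => r s hr hs e.
have /andP[/eqP sr _] := allP rows17_ok r hr; have /andP[/eqP ss _] := allP rows17_ok s hs.
apply: (@eq_from_nth _ 0); rewrite ?sr ?ss // => i hi.
have := row_pointP (Ordinal hi) hr; rewrite e inE /= inordK ?rows17_lt //.
by move/eqP.
Qed.

Lemma tau_edges17 : tau edges17 = 6.
Proof.
have hT := @partite_cover 7 _ _ isT edges17_partite.
apply/eqP; rewrite eqn_leq; apply/andP; split.
  (* The six vertices of the first side form a cover. *)
  have /(tau_le hT) h : vertex_cover edges17 [set row_point [:: i : nat] ord0 | i : 'I_6].
    apply/forallP=> e; apply/implyP=> /edges17P[r hr ->]; apply/set0Pn.
    exists (row_point r ord0); rewrite in_setI row_pointP //=.
    apply/imsetP; exists (inord (nth 0 r 0)) => //.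
    by rewrite /row_point /= inordK // rows17_lt.
  by apply: leq_trans h _; apply: leq_trans (leq_imset_card _ _) _; rewrite card_ord.
apply: tau_ge => // C hC; rewrite leqNgt; apply/negP => lt6.
have := rows17_not_coverable; rewrite (@coverableP _ _ C) // => r hr.
by have /forallP/(_ (row_edge r))/implyP := hC; apply; apply/edges17P; exists r.
Qed.

Theorem theorem10 :
  f_is 7 17 /\
  exists (T : finType) (H : {set {set T}}),
    [/\ partite 7 H, intersecting H & tau H = 6].
Proof.
split; last first.
  exists _, edges17; split; [exact: edges17_partite | exact: edges17_intersecting |].
  exact: tau_edges17.
split; last exact: witness7_ge17.
exists _, edges17; split; [exact: edges17_partite | exact: edges17_intersecting | |].
  exact: card_edges17.
by rewrite tau_edges17.
Qed.
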